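(* Let $m,n$ be positive integers. For $\sigma,\rho\in\mathfrak{S}_m$, $\sigma',\rho'\in\mathfrak{S}_n$, and $1\le k<m+n$, there is an isomorphism of $H_k(0)\otimes H_{m+n-k}(0)$-modules $$\big(\mathsf{B}(\sigma,\rho)\boxtimes\mathsf{B}(\sigma',\rho')\big)\downarrow^{H_{m+n}(0)}_{H_k(0)\otimes H_{m+n-k}(0)}\;\cong\;\bigoplus_{\substack{t+s=k\\ t\le m,\ s\le n}}\mathtt{T}_{t,s}\Big(\mathsf{B}(\sigma,\rho)\downarrow^{H_m(0)}_{H_t(0)\otimes H_{m-t}(0)}\otimes\,\mathsf{B}(\sigma',\rho')\downarrow^{H_n(0)}_{H_s(0)\otimes H_{n-s}(0)}\Big)\uparrow^{H_k(0)\otimes H_{m+n-k}(0)}_{H_t(0)\otimes H_s(0)\otimes H_{m-t}(0)\otimes H_{n-s}(0)},$$ where $t,s$ range over nonnegative integers.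
   Context: Permutations are composed as functions; $s_i=(i,i+1)$; $\ell$ is the Coxeter length; $\mathrm{Des}_L(\sigma)=\{i\mid \ell(s_i\sigma)<\ell(\sigma)\}$. Left weak Bruhat order: $\sigma\preceq_L\rho$ iff $\rho=\gamma\sigma$ with $\ell(\rho)=\ell(\gamma)+\ell(\sigma)$ for some $\gamma$; $[\sigma,\rho]_L=\{\gamma\mid\sigma\preceq_L\gamma\preceq_L\rho\}$ (possibly empty). $H_N(0)$ is the unital $\mathbb{C}$-algebra generated by $\pi_1,\dots,\pi_{N-1}$ with relations $\pi_i^2=\pi_i$, $\pi_i\pi_{i+1}\pi_i=\pi_{i+1}\pi_i\pi_{i+1}$, $\pi_i\pi_j=\pi_j\pi_i$ for $|i-j|\ge2$ (so $H_0(0)=H_1(0)=\mathbb{C}$). $H_a(0)\otimes H_b(0)$ is viewed as the subalgebra of $H_{a+b}(0)$ generated by $\{\pi_i\mid i\in[a+b-1]\setminus\{a\}\}$ ($\pi_i\otimes1\mapsto\pi_i$, $1\otimes\pi_j\mapsto\pi_{a+j}$). $\downarrow$ denotes restriction and $\uparrow$ denotes induction ($M\uparrow^A_B=A\otimes_BM$). The induction product is $M\boxtimes N:=(M\otimes N)\uparrow^{H_{a+b}(0)}_{H_a(0)\otimes H_b(0)}$ for an $H_a(0)$-module $M$ and an $H_b(0)$-module $N$. $\mathtt{T}_{t,s}$ is the functor from finite-dimensional modules over $H_t(0)\otimes H_{m-t}(0)\otimes H_s(0)\otimes H_{n-s}(0)$ to finite-dimensional modules over $H_t(0)\otimes H_s(0)\otimes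 H_{m-t}(0)\otimes H_{n-s}(0)$ interchanging the two middle tensor factors, i.e. sending $M_1\otimes M_2\otimes N_1\otimes N_2$ to $M_1\otimes N_1\otimes M_2\otimes N_2$. Here $H_t(0)\otimes H_s(0)\subseteq H_k(0)$ and $H_{m-t}(0)\otimes H_{n-s}(0)\subseteq H_{m+n-k}(0)$. For $\sigma,\rho\in\mathfrak{S}_N$, $\mathsf{B}(\sigma,\rho)$ is the left $H_N(0)$-module with basis $[\sigma,\rho]_L$ and action: $\pi_i\cdot\gamma=\gamma$ if $i\in\mathrm{Des}_L(\gamma)$; $0$ if $i\notin\mathrm{Des}_L(\gamma)$ and $s_i\gamma\notin[\sigma,\rho]_L$; $s_i\gamma$ if $i\notin\mathrm{Des}_L(\gamma)$ and $s_i\gamma\in[\sigma,\rho]_L$. *)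

(* Defs.v *)
From HB Require Import structures.
From mathcomp Require Import all_boot all_order all_algebra all_fingroup.
From mathcomp Require Import zify.
From mathcomp Require Import boolp generic_quotient.

Set Implicit Arguments.
Unset Strict Implicit.
Unset Printing Implicit Defensive.

Import GRing.Theory.
Local Open Scope quotient_scope.
Local Open Scope ring_scope.

(* MathComp's algType requires 1 != 0, which would have to be proved for every
   quotient below; a pzAlgType K is a unital associative K-algebra without that
   requirement, given by a ring A and a central ring morphism from K to A. *)
HB.mixin Record isPzAlgebra (K : fieldType) A of GRing.PzRing A := {
  scal_subdef : K -> A;
  scal_zmod : zmod_morphism scal_subdef;
  scal_monoid : monoid_morphism scal_subdef;
  scal_central : forall c x, scal_subdef c * x = x * scal_subdef c
}.

#[short(type="pzAlgType")]
HB.structure Definition PzAlgebra (K : fieldType) :=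
  {A of GRing.PzRing A & isPzAlgebra K A}.

Definition scal {K : fieldType} {A : pzAlgType K} : K -> A :=
  @scal_subdef K A.
HB.instance Definition _ (K : fieldType) (A : pzAlgType K) :=
  GRing.isZmodMorphism.Build K A scal (@scal_zmod K A).
HB.instance Definition _ (K : fieldType) (A : pzAlgType K) :=
  GRing.isMonoidMorphism.Build K A scal (@scal_monoid K A).

Lemma scalC (K : fieldType) (A : pzAlgType K) (c : K) (x : A) :
  scal c * x = x * scal c.
Proof. exact: scal_central. Qed.

HB.mixin Record isScalMorphism (K : fieldType) (A B : pzAlgType K) (f : A -> B)
  := { scal_morphism : forall c, f (scal c) = scal c }.

#[short(type="algHom")]
HB.structure Definition AlgHom (K : fieldType) (A B : pzAlgType K) :=
  {f of @GRing.RMorphism A B f & isScalMorphism K A B f}.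

Section AlgHomComp.
Context {K : fieldType} {A B C : pzAlgType K}.
Variables (g : algHom B C) (f : algHom A B).
Lemma comp_scal c : (g \o f) (scal c) = scal c.
Proof. by rewrite /= !scal_morphism. Qed.
HB.instance Definition _ :=
  isScalMorphism.Build K A C (g \o f) comp_scal.
Definition alg_comp : algHom A C := g \o f.
End AlgHomComp.

Section Quotient.
Variables (T : Type) (r : T -> T -> Prop).
Hypotheses (rr : forall x, r x x) (rs : forall x y, r x y -> r y x)
           (rt : forall x y z, r x y -> r y z -> r x z).

Definition quo_rel (x y : {classic T}) : bool := `[< r x y >].

Lemma quo_equiv : equiv_class_of quo_rel.
Proof.
split=> [x|x y|y x z]; first exact/asboolP.
  by apply/asboolP/asboolP; apply: rs.
by move=> /asboolP xy /asboolP yz; apply/asboolP; apply: rt xy yz.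
Qed.

Definition quo_equiv_rel : equiv_rel {classic T} := EquivRelPack quo_equiv.

End Quotient.

Section Presented.
Variables (K : fieldType) (X : Type).

Inductive aterm : Type :=
  | AGen of X
  | AScal of K
  | AAdd of aterm & aterm
  | AMul of aterm & aterm.

Variable rel : aterm -> aterm -> Prop.

Inductive acong : aterm -> aterm -> Prop :=
  | ac_rel s t : rel s t -> acong s t
  | ac_refl s : acong s s
  | ac_sym s t : acong s t -> acong t s
  | ac_trans s t u : acong s t -> acong t u -> acong s u
  | ac_add s s' t t' : acong s s' -> acong t t' ->
      acong (AAdd s t) (AAdd s' t')
  | ac_mul s s' t t' : acong s s' -> acong t t' ->
      acong (AMul s t) (AMul s' t')
  | ac_addA s t u : acong (AAdd s (AAdd t u)) (AAdd (AAdd s t) u)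
  | ac_addC s t : acong (AAdd s t) (AAdd t s)
  | ac_add0 s : acong (AAdd (AScal 0) s) s
  | ac_addN s : acong (AAdd (AMul (AScal (-1)) s) s) (AScal 0)
  | ac_mulA s t u : acong (AMul s (AMul t u)) (AMul (AMul s t) u)
  | ac_mul1 s : acong (AMul (AScal 1) s) s
  | ac_mulDl s t u : acong (AMul (AAdd s t) u) (AAdd (AMul s u) (AMul t u))
  | ac_mulDr s t u : acong (AMul s (AAdd t u)) (AAdd (AMul s t) (AMul s u))
  | ac_scalD c d : acong (AScal (c + d)) (AAdd (AScal c) (AScal d))
  | ac_scalM c d : acong (AScal (c * d)) (AMul (AScal c) (AScal d))
  | ac_scalC c s : acong (AMul (AScal c) s) (AMul s (AScal c)).

Definition presAlg : Type :=
  {eq_quot quo_equiv_rel ac_refl ac_sym ac_trans}.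

HB.instance Definition _ := Choice.on presAlg.

Definition pcls (t : aterm) : presAlg := \pi_presAlg (t : {classic aterm}).

Lemma pclsP s t : pcls s = pcls t <-> acong s t.
Proof.
split=> [/eqmodP/asboolP //|st].
by apply/eqmodP/asboolP.
Qed.

Lemma pclsK (x : presAlg) : pcls (repr x) = x.
Proof. exact: reprK. Qed.

Lemma pcls_repr t : acong (repr (pcls t)) t.
Proof. by apply/pclsP; rewrite pclsK. Qed.

Definition padd (x y : presAlg) := pcls (AAdd (repr x) (repr y)).
Definition pmul (x y : presAlg) := pcls (AMul (repr x) (repr y)).
Definition popp (x : presAlg) := pcls (AMul (AScal (-1)) (repr x)).

Lemma paddE s t : padd (pcls s) (pcls t) = pcls (AAdd s t).
Proof. by apply/pclsP/ac_add; apply: pcls_repr. Qed.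

Lemma pmulE s t : pmul (pcls s) (pcls t) = pcls (AMul s t).
Proof. by apply/pclsP/ac_mul; apply: pcls_repr. Qed.

Lemma poppE s : popp (pcls s) = pcls (AMul (AScal (-1)) s).
Proof. by apply/pclsP/ac_mul; [apply: ac_refl|apply: pcls_repr]. Qed.

Lemma pindP (P : presAlg -> Prop) : (forall t, P (pcls t)) -> forall x, P x.
Proof. by move=> Pt x; rewrite -(pclsK x). Qed.

Lemma paddA : associative padd.
Proof.
elim/pindP=> s; elim/pindP=> t; elim/pindP=> u.
rewrite !paddE; apply/pclsP; exact: ac_addA.
Qed.

Lemma paddC : commutative padd.
Proof.
elim/pindP=> s; elim/pindP=> t; rewrite !paddE; apply/pclsP; exact: ac_addC.
Qed.

Lemma padd0 : left_id (pcls (AScal 0)) padd.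
Proof. elim/pindP=> s; rewrite !paddE; apply/pclsP; exact: ac_add0. Qed.

Lemma paddN : left_inverse (pcls (AScal 0)) popp padd.
Proof. elim/pindP=> s; rewrite poppE paddE; apply/pclsP; exact: ac_addN. Qed.

HB.instance Definition _ := GRing.isZmodule.Build presAlg paddA paddC padd0 paddN.

Lemma pmulA : associative pmul.
Proof.
elim/pindP=> s; elim/pindP=> t; elim/pindP=> u.
rewrite !pmulE; apply/pclsP; exact: ac_mulA.
Qed.

Lemma pmul1 : left_id (pcls (AScal 1)) pmul.
Proof. elim/pindP=> s; rewrite !pmulE; apply/pclsP; exact: ac_mul1. Qed.

Lemma pmulr1 : right_id (pcls (AScal 1)) pmul.
Proof.
elim/pindP=> s; rewrite !pmulE; apply/pclsP.
exact: ac_trans (ac_sym (ac_scalC _ _)) (ac_mul1 _).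
Qed.

Lemma pmulDl : left_distributive pmul +%R.
Proof.
elim/pindP=> s; elim/pindP=> t; elim/pindP=> u.
rewrite /GRing.add /= !(paddE, pmulE); apply/pclsP; exact: ac_mulDl.
Qed.

Lemma pmulDr : right_distributive pmul +%R.
Proof.
elim/pindP=> s; elim/pindP=> t; elim/pindP=> u.
rewrite /GRing.add /= !(paddE, pmulE); apply/pclsP; exact: ac_mulDr.
Qed.

HB.instance Definition _ :=
  GRing.Zmodule_isPzRing.Build presAlg pmulA pmul1 pmulr1 pmulDl pmulDr.

Lemma pclsD s t : pcls (AAdd s t) = pcls s + pcls t.
Proof. by rewrite -paddE. Qed.

Lemma pclsM s t : pcls (AMul s t) = pcls s * pcls t.
Proof. by rewrite -pmulE. Qed.

Lemma pcls1 : pcls (AScal 1) = 1.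
Proof. by []. Qed.

Lemma pcls0 : pcls (AScal 0) = 0.
Proof. by []. Qed.

Lemma pclsSD c d : pcls (AScal (c + d)) = pcls (AScal c) + pcls (AScal d).
Proof. by rewrite -pclsD; apply/pclsP/ac_scalD. Qed.

Lemma pclsSM c d : pcls (AScal (c * d)) = pcls (AScal c) * pcls (AScal d).
Proof. by rewrite -pclsM; apply/pclsP/ac_scalM. Qed.

Lemma pclsSC c x : pcls (AScal c) * x = x * pcls (AScal c).
Proof. by elim/pindP: x => t; rewrite -!pclsM; apply/pclsP/ac_scalC. Qed.

Definition pscal (c : K) : presAlg := pcls (AScal c).

Lemma pscal_zmod : zmod_morphism pscal.
Proof.
move=> c d; apply: (addIr (pscal d)).
by rewrite /pscal -pclsSD !subrK.
Qed.

Lemma pscal_monoid : monoid_morphism pscal.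
Proof. by split=> // c d; exact: pclsSM. Qed.

HB.instance Definition _ :=
  isPzAlgebra.Build K presAlg pscal_zmod pscal_monoid pclsSC.

Definition pgen (x : X) : presAlg := pcls (AGen x).

Lemma pclsS c : pcls (AScal c) = scal c.
Proof. by []. Qed.

Lemma pcls_rel s t : rel s t -> pcls s = pcls t.
Proof. by move=> st; apply/pclsP/ac_rel. Qed.

Section Lift.
Variables (A : pzAlgType K) (g : X -> A).

Fixpoint aeval (t : aterm) : A :=
  match t with
  | AGen x => g x
  | AScal c => scal c
  | AAdd s t => aeval s + aeval t
  | AMul s t => aeval s * aeval t
  end.

Hypothesis g_rel : forall s t, rel s t -> aeval s = aeval t.

Lemma aeval_cong s t : acong s t -> aeval s = aeval t.
Proof.
elim=> {s t} //=.
- by move=> s t u _ -> _ ->.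
- by move=> s s' t t' _ -> _ ->.
- by move=> s s' t t' _ -> _ ->.
- by move=> s t u; rewrite addrA.
- by move=> s t; rewrite addrC.
- by move=> s; rewrite rmorph0 add0r.
- by move=> s; rewrite rmorphN1 rmorph0 mulN1r addNr.
- by move=> s t u; rewrite mulrA.
- by move=> s; rewrite rmorph1 mul1r.
- by move=> s t u; rewrite mulrDl.
- by move=> s t u; rewrite mulrDr.
- by move=> c d; rewrite rmorphD.
- by move=> c d; rewrite rmorphM.
- by move=> c s; rewrite scalC.
Qed.

Definition plift_def of (forall s t, rel s t -> aeval s = aeval t) :=
  fun x : presAlg => aeval (repr x).
Local Notation plift_fun := (plift_def g_rel).

Lemma plift_cls t : plift_fun (pcls t) = aeval t.
Proof. exact/aeval_cong/pcls_repr. Qed.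

Lemma plift_zmod : zmod_morphism plift_fun.
Proof.
elim/pindP=> s; elim/pindP=> t.
have N1 : -1 = pcls (AScal (-1)) by rewrite pclsS rmorphN1.
rewrite -mulN1r N1 -pclsM -pclsD.
by rewrite !plift_cls /= rmorphN1 mulN1r.
Qed.

Lemma plift_monoid : monoid_morphism plift_fun.
Proof.
split; first by rewrite -pcls1 plift_cls /= rmorph1.
by elim/pindP=> s; elim/pindP=> t; rewrite -pclsM !plift_cls.
Qed.

Lemma plift_scal c : plift_fun (scal c) = scal c.
Proof. exact: plift_cls (AScal c). Qed.

HB.instance Definition _ :=
  GRing.isZmodMorphism.Build presAlg A plift_fun plift_zmod.
HB.instance Definition _ :=
  GRing.isMonoidMorphism.Build presAlg A plift_fun plift_monoid.
HB.instance Definition _ :=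
  isScalMorphism.Build K presAlg A plift_fun plift_scal.

Definition plift : algHom presAlg A := plift_fun.

Lemma plift_gen x : plift (pgen x) = g x.
Proof. exact: plift_cls. Qed.

End Lift.

(* A family of K-linear operators satisfying the relations makes a K-vector
   space into a module over the presented algebra. *)
Section Operators.
Variables (V : lmodType K) (op : X -> {linear V -> V}).

Fixpoint oact (t : aterm) (v : V) : V :=
  match t with
  | AGen x => op x v
  | AScal c => c *: v
  | AAdd s t => oact s v + oact t v
  | AMul s t => oact s (oact t v)
  end.

Lemma oactD t : {morph oact t : u v / u + v}.
Proof.
elim: t => [x|c|s IHs t IHt|s IHs t IHt] u v /=.
- exact: raddfD.
- exact: scalerDr.
- by rewrite IHs IHt addrACA.
- by rewrite IHt IHs.
Qed.

Lemma oactZ t c v : oact t (c *: v) = c *: oact t v.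
Proof.
elim: t v => [x|d|s IHs t IHt|s IHs t IHt] v /=.
- exact: linearZ.
- by rewrite !scalerA mulrC.
- by rewrite IHs IHt scalerDr.
- by rewrite IHt IHs.
Qed.

Hypothesis op_rel : forall s t, rel s t -> oact s =1 oact t.

Lemma oact_cong s t : acong s t -> oact s =1 oact t.
Proof.
elim=> {s t}.
- exact: op_rel.
- by [].
- by move=> s t _ IH v; rewrite IH.
- by move=> s t u _ IH1 _ IH2 v; rewrite IH1 IH2.
- by move=> s s' t t' _ IH1 _ IH2 v /=; rewrite IH1 IH2.
- by move=> s s' t t' _ IH1 _ IH2 v /=; rewrite IH2 IH1.
- by move=> s t u v /=; rewrite addrA.
- by move=> s t v /=; rewrite addrC.
- by move=> s v /=; rewrite scale0r add0r.
- by move=> s v /=; rewrite scaleN1r addNr scale0r.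
- by [].
- by move=> s v /=; rewrite scale1r.
- by [].
- by move=> s t u v /=; rewrite oactD.
- by move=> c d v /=; rewrite scalerDl.
- by move=> c d v /=; rewrite scalerA.
- by move=> c s v /=; rewrite oactZ.
Qed.

Definition pact (x : presAlg) (v : V) : V := oact (repr x) v.

Lemma pact_cls t v : pact (pcls t) v = oact t v.
Proof. exact/oact_cong/pcls_repr. Qed.

Lemma pactA a b v : pact a (pact b v) = pact (a * b) v.
Proof. by elim/pindP: a => s; elim/pindP: b => t; rewrite -pclsM !pact_cls. Qed.

Lemma pact1 : left_id 1 pact.
Proof. by move=> v; rewrite -pcls1 pact_cls /= scale1r. Qed.

Lemma pactDr : right_distributive pact +%R.
Proof. by move=> a u v; apply: oactD. Qed.

Lemma pactDl v : {morph pact^~ v : a b / a + b}.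
Proof. by elim/pindP=> s; elim/pindP=> t; rewrite -pclsD !pact_cls. Qed.

End Operators.

End Presented.

Section Tensor.
Variables (S : Type) (V W : zmodType) (ra : S -> V -> V) (la : S -> W -> W).

Inductive tterm : Type :=
  | TPure of V & W
  | TZero
  | TOpp of tterm
  | TAdd of tterm & tterm.

Inductive tcong : tterm -> tterm -> Prop :=
  | tc_refl x : tcong x x
  | tc_sym x y : tcong x y -> tcong y x
  | tc_trans x y z : tcong x y -> tcong y z -> tcong x z
  | tc_opp x x' : tcong x x' -> tcong (TOpp x) (TOpp x')
  | tc_add x x' y y' : tcong x x' -> tcong y y' -> tcong (TAdd x y) (TAdd x' y')
  | tc_addA x y z : tcong (TAdd x (TAdd y z)) (TAdd (TAdd x y) z)
  | tc_addC x y : tcong (TAdd x y) (TAdd y x)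
  | tc_add0 x : tcong (TAdd TZero x) x
  | tc_addN x : tcong (TAdd (TOpp x) x) TZero
  | tc_pureDl v v' w : tcong (TPure (v + v') w) (TAdd (TPure v w) (TPure v' w))
  | tc_pureDr v w w' : tcong (TPure v (w + w')) (TAdd (TPure v w) (TPure v w'))
  | tc_pureS s v w : tcong (TPure (ra s v) w) (TPure v (la s w)).

Definition tensor : Type :=
  {eq_quot quo_equiv_rel tc_refl tc_sym tc_trans}.

HB.instance Definition _ := Choice.on tensor.

Definition tcls (t : tterm) : tensor := \pi_tensor (t : {classic tterm}).

Lemma tclsP s t : tcls s = tcls t <-> tcong s t.
Proof.
split=> [/eqmodP/asboolP //|st].
by apply/eqmodP/asboolP.
Qed.

Lemma tclsK (x : tensor) : tcls (repr x) = x.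
Proof. exact: reprK. Qed.

Lemma tcls_repr t : tcong (repr (tcls t)) t.
Proof. by apply/tclsP; rewrite tclsK. Qed.

Definition tadd (x y : tensor) := tcls (TAdd (repr x) (repr y)).
Definition topp (x : tensor) := tcls (TOpp (repr x)).

Lemma taddE s t : tadd (tcls s) (tcls t) = tcls (TAdd s t).
Proof. by apply/tclsP/tc_add; apply: tcls_repr. Qed.

Lemma toppE s : topp (tcls s) = tcls (TOpp s).
Proof. by apply/tclsP/tc_opp/tcls_repr. Qed.

Lemma tclsW (P : tensor -> Prop) : (forall t, P (tcls t)) -> forall x, P x.
Proof. by move=> Pt x; rewrite -(tclsK x). Qed.

Lemma taddA : associative tadd.
Proof.
elim/tclsW=> s; elim/tclsW=> t; elim/tclsW=> u.
rewrite !taddE; apply/tclsP; exact: tc_addA.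
Qed.

Lemma taddC : commutative tadd.
Proof.
elim/tclsW=> s; elim/tclsW=> t; rewrite !taddE; apply/tclsP; exact: tc_addC.
Qed.

Lemma tadd0 : left_id (tcls TZero) tadd.
Proof. elim/tclsW=> s; rewrite !taddE; apply/tclsP; exact: tc_add0. Qed.

Lemma taddN : left_inverse (tcls TZero) topp tadd.
Proof. elim/tclsW=> s; rewrite toppE taddE; apply/tclsP; exact: tc_addN. Qed.

HB.instance Definition _ := GRing.isZmodule.Build tensor taddA taddC tadd0 taddN.

Definition tpure (v : V) (w : W) : tensor := tcls (TPure v w).

Lemma tclsD s t : tcls (TAdd s t) = tcls s + tcls t.
Proof. by rewrite -taddE. Qed.

Lemma tclsN s : tcls (TOpp s) = - tcls s.
Proof. by rewrite -toppE. Qed.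

Lemma tpureDl v v' w : tpure (v + v') w = tpure v w + tpure v' w.
Proof. by rewrite -tclsD; apply/tclsP/tc_pureDl. Qed.

Lemma tpureDr v w w' : tpure v (w + w') = tpure v w + tpure v w'.
Proof. by rewrite -tclsD; apply/tclsP/tc_pureDr. Qed.

Lemma tpureS s v w : tpure (ra s v) w = tpure v (la s w).
Proof. by apply/tclsP/tc_pureS. Qed.

Lemma tensor_indP (P : tensor -> Prop) :
  (forall v w, P (tpure v w)) -> (forall x y, P x -> P y -> P (x - y)) ->
  forall x, P x.
Proof.
move=> Pp PB.
have P0 : P 0 by rewrite -(subrr (tpure 0 0)); apply: PB.
elim/tclsW; elim=> [v w||s IHs|s IHs t IHt].
- exact: Pp.
- exact: P0.
- by rewrite tclsN -sub0r; apply: PB.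
- rewrite tclsD -[tcls t]opprK; apply/PB => //.
  by rewrite -sub0r; apply: PB.
Qed.

Lemma tensor_ext (Z : zmodType) (f g : {additive tensor -> Z}) :
  (forall v w, f (tpure v w) = g (tpure v w)) -> f =1 g.
Proof.
by move=> fg; elim/tensor_indP => // x y fgx fgy; rewrite !raddfB fgx fgy.
Qed.

Section Lift.
Variables (Z : zmodType) (f : V -> W -> Z).

Record balanced : Prop := Balanced {
  balancedDl : forall v v' w, f (v + v') w = f v w + f v' w;
  balancedDr : forall v w w', f v (w + w') = f v w + f v w';
  balancedS : forall s v w, f (ra s v) w = f v (la s w)
}.

Fixpoint teval (t : tterm) : Z :=
  match t with
  | TPure v w => f v w
  | TZero => 0
  | TOpp s => - teval s
  | TAdd s t => teval s + teval t
  end.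

Lemma teval_cong : balanced -> forall s t, tcong s t -> teval s = teval t.
Proof.
case=> fDl fDr fS s t; elim=> {s t} //=.
- by move=> x y z _ -> _ ->.
- by move=> x x' _ ->.
- by move=> x x' y y' _ -> _ ->.
- by move=> x y z; rewrite addrA.
- by move=> x y; rewrite addrC.
- by move=> x; rewrite add0r.
- by move=> x; rewrite addNr.
Qed.

Definition tlift_def of balanced := fun x : tensor => teval (repr x).

Hypothesis bal_f : balanced.

Lemma tlift_cls t : tlift_def bal_f (tcls t) = teval t.
Proof. exact/(teval_cong bal_f)/tcls_repr. Qed.

Lemma tlift_zmod : zmod_morphism (tlift_def bal_f).
Proof.
by elim/tclsW=> s; elim/tclsW=> t; rewrite -tclsN -tclsD !tlift_cls.
Qed.

HB.instance Definition _ :=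
  GRing.isZmodMorphism.Build tensor Z (tlift_def bal_f) tlift_zmod.

Definition tlift : {additive tensor -> Z} := tlift_def bal_f.

Lemma tliftE v w : tlift (tpure v w) = f v w.
Proof. exact: tlift_cls. Qed.

End Lift.

End Tensor.

Arguments tpure {S V W ra la} v w.
Arguments tpureS {S V W ra la} s v w.

(* A module M over a K-algebra A is a K-vector space through scal : K -> A. *)
Definition modT (K : fieldType) (A B : pzAlgType K)
    (M : lmodType A) (N : lmodType B) : Type :=
  tensor (fun (c : K) (m : M) => (scal c : A) *: m)
         (fun (c : K) (n : N) => (scal c : B) *: n).

Section ModT.
Context {K : fieldType} {A B : pzAlgType K} (M : lmodType A) (N : lmodType B).

HB.instance Definition _ := GRing.Zmodule.on (modT M N).

Lemma scal_scaleC (c : K) (a : A) (m : M) :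
  a *: ((scal c : A) *: m) = (scal c : A) *: (a *: m).
Proof. by rewrite !scalerA scalC. Qed.

End ModT.

Section ModTAction.
Context {K : fieldType} {A B : pzAlgType K} (M : lmodType A) (N : lmodType B).

Definition pureact_fun (a : A) (b : B) (m : M) (n : N) : modT M N :=
  tpure (a *: m) (b *: n).

Lemma pureact_bal a b :
  balanced (fun (c : K) (m : M) => (scal c : A) *: m)
           (fun (c : K) (n : N) => (scal c : B) *: n) (pureact_fun a b).
Proof.
split; rewrite /pureact_fun.
- by move=> v v' w; rewrite scalerDr tpureDl.
- by move=> v w w'; rewrite scalerDr tpureDr.
- by move=> c v w; rewrite !scal_scaleC (tpureS c).
Qed.

Definition pureact a b : {additive modT M N -> modT M N} :=
  tlift (pureact_bal a b).

Lemma pureactE a b m n : pureact a b (tpure m n) = tpure (a *: m) (b *: n).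
Proof. exact: tliftE. Qed.

Lemma pureact_bal2 (x : modT M N) :
  balanced (fun (c : K) (a : A^o) => (scal c : A) *: a)
           (fun (c : K) (b : B^o) => (scal c : B) *: b)
           (fun a b => pureact a b x).
Proof.
split.
- move=> a a' b; elim/tensor_indP: x => [m n|x y IHx IHy].
    by rewrite !pureactE scalerDl tpureDl.
  by rewrite !raddfB /= IHx IHy opprD addrACA.
- move=> a b b'; elim/tensor_indP: x => [m n|x y IHx IHy].
    by rewrite !pureactE scalerDl tpureDr.
  by rewrite !raddfB /= IHx IHy opprD addrACA.
- move=> c a b; elim/tensor_indP: x => [m n|x y IHx IHy].
    by rewrite !pureactE -!scalerA (tpureS c).
  by rewrite !raddfB /= IHx IHy.
Qed.

End ModTAction.

(* A^o is A as a left module over itself. *)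
Definition algT (K : fieldType) (A B : pzAlgType K) : Type := modT A^o B^o.

Section Tact.
Context {K : fieldType} {A B : pzAlgType K}.
HB.instance Definition _ := GRing.Zmodule.on (algT A B).

Definition apure (a : A) (b : B) : algT A B := @tpure _ A^o B^o _ _ a b.

Definition tact {M : lmodType A} {N : lmodType B} (x : algT A B) (y : modT M N) :
    modT M N :=
  tlift (pureact_bal2 y) x.

Section Theory.
Variables (M : lmodType A) (N : lmodType B).
Implicit Types (x : algT A B) (y : modT M N).

Lemma tact_pure a b m n :
  tact (apure a b) (tpure m n : modT M N) = tpure (a *: m) (b *: n).
Proof. by rewrite /tact tliftE pureactE. Qed.

Lemma tact_pureE a b y : tact (apure a b) y = pureact M N a b y.
Proof. exact: tliftE. Qed.

Lemma tactBl y : {morph tact^~ y : x x' / x - x'}.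
Proof. by move=> x x'; rewrite /tact raddfB. Qed.

Lemma tactDl y : {morph tact^~ y : x x' / x + x'}.
Proof. by move=> x x'; rewrite /tact raddfD. Qed.

Lemma algT_indP (P : algT A B -> Prop) :
  (forall a b, P (apure a b)) -> (forall x x', P x -> P x' -> P (x - x')) ->
  forall x, P x.
Proof. exact: tensor_indP. Qed.

Lemma tactBr x : {morph @tact M N x : y y' / y - y'}.
Proof.
move=> y y'; elim/algT_indP: x => [a b|x x' IH IH'].
  by rewrite !tact_pureE raddfB.
by rewrite !tactBl IH IH' !opprD !opprK addrACA.
Qed.

Lemma tactDr x : {morph @tact M N x : y y' / y + y'}.
Proof.
move=> y y'; elim/algT_indP: x => [a b|x x' IH IH'].
  by rewrite !tact_pureE raddfD.
by rewrite !tactBl IH IH' opprD addrACA.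
Qed.

Lemma tact1 y : tact (apure 1 1) y = y.
Proof.
elim/tensor_indP: y => [m n|y y' IH IH']; first by rewrite tact_pure !scale1r.
by rewrite tactBr IH IH'.
Qed.
End Theory.

Definition amul (x y : algT A B) : algT A B := @tact A^o B^o x y.

Lemma amulE a b a' b' :
  amul (apure a b) (apure a' b') = apure (a * a') (b * b').
Proof. exact: tact_pure. Qed.

Lemma tactA (M : lmodType A) (N : lmodType B) (x x' : algT A B) (y : modT M N) :
  tact x (tact x' y) = tact (amul x x') y.
Proof.
elim/algT_indP: x => [a b|x1 x2 IH1 IH2]; last first.
  by rewrite tactBl IH1 IH2 -tactBl /amul -tactBl.
elim/algT_indP: x' => [a' b'|x1 x2 IH1 IH2]; last first.
  by rewrite tactBl tactBr IH1 IH2 -tactBl /amul -tactBr.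
elim/tensor_indP: y => [m n|y1 y2 IH1 IH2]; last first.
  by rewrite !tactBr IH1 IH2.
by rewrite amulE !tact_pure !scalerA.
Qed.

Lemma amulA : associative amul.
Proof. by move=> x y z; exact: (@tactA A^o B^o). Qed.

Lemma amul1 : left_id (apure 1 1) amul.
Proof. exact: (@tact1 A^o B^o). Qed.

Lemma amulr1 : right_id (apure 1 1) amul.
Proof.
elim/algT_indP => [a b|x y IHx IHy]; first by rewrite amulE !mulr1.
by rewrite /amul tactBl; congr (_ - _).
Qed.

Lemma amulDl : left_distributive amul +%R.
Proof. by move=> x y z; rewrite /amul tactDl. Qed.

Lemma amulDr : right_distributive amul +%R.
Proof. by move=> x y z; rewrite /amul tactDr. Qed.

HB.instance Definition _ := GRing.Zmodule_isPzRing.Build (algT A B)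
  amulA amul1 amulr1 amulDl amulDr.

Lemma apureM a b a' b' : apure a b * apure a' b' = apure (a * a') (b * b').
Proof. exact: amulE. Qed.

Lemma apureDl a a' b : apure (a + a') b = apure a b + apure a' b.
Proof. exact: tpureDl. Qed.

Lemma apureDr a b b' : apure a (b + b') = apure a b + apure a b'.
Proof. exact: tpureDr. Qed.

Lemma apureS c a b : apure (scal c * a) b = apure a (scal c * b).
Proof. exact: (tpureS c (a : A^o) (b : B^o)). Qed.

Definition ascal (c : K) : algT A B := apure (scal c) 1.

Lemma ascal_zmod : zmod_morphism ascal.
Proof.
move=> c d; apply: (addIr (ascal d)).
by rewrite /ascal -apureDl -rmorphD !subrK.
Qed.

Lemma ascal_monoid : monoid_morphism ascal.
Proof.
split=> [|c d]; rewrite /ascal ?rmorph1 //.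
by rewrite rmorphM apureM mulr1.
Qed.

Lemma ascal_central c x : ascal c * x = x * ascal c.
Proof.
elim/algT_indP: x => [a b|x y IHx IHy].
  by rewrite /ascal !apureM mulr1 mul1r scalC.
by rewrite mulrBr IHx IHy mulrBl.
Qed.

HB.instance Definition _ := isPzAlgebra.Build K (algT A B)
  ascal_zmod ascal_monoid ascal_central.

HB.instance Definition _ (M : lmodType A) (N : lmodType B) :=
  GRing.Zmodule_isLmodule.Build (algT A B) (modT M N)
    (@tactA M N) (@tact1 M N) (@tactDr M N) (@tactDl M N).

End Tact.

Lemma modT_scaleE (K : fieldType) (A B : pzAlgType K)
    (M : lmodType A) (N : lmodType B) a b (m : M) (n : N) :
  apure a b *: (tpure m n : modT M N) = tpure (a *: m) (b *: n).
Proof. exact: tact_pure. Qed.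

Section AlgLift.
Context {K : fieldType} {A B C : pzAlgType K}.
Variables (f : algHom A C) (g : algHom B C).

Definition alg_lift_fun (a : A^o) (b : B^o) : C := f a * g b.

Lemma alg_lift_bal :
  balanced (fun (c : K) (a : A^o) => (scal c : A) *: a)
           (fun (c : K) (b : B^o) => (scal c : B) *: b) alg_lift_fun.
Proof.
rewrite /alg_lift_fun; split.
- by move=> a a' b; rewrite rmorphD mulrDl.
- by move=> a b b'; rewrite rmorphD mulrDr.
- move=> c a b; change (f (scal c * (a : A)) * g b = f a * g (scal c * (b : B))).
  by rewrite !rmorphM /= !scal_morphism mulrA scalC.
Qed.

Definition alg_lift_def of (forall a b, f a * g b = g b * f a) :=
  (tlift alg_lift_bal : algT A B -> C).

Hypothesis fg : forall a b, f a * g b = g b * f a.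

Lemma alg_lift_pure a b : alg_lift_def fg (apure a b) = f a * g b.
Proof. exact: tliftE. Qed.

Lemma alg_lift_zmod : zmod_morphism (alg_lift_def fg).
Proof. by move=> x y; rewrite /alg_lift_def raddfB. Qed.

HB.instance Definition _ :=
  GRing.isZmodMorphism.Build (algT A B) C (alg_lift_def fg) alg_lift_zmod.

Lemma alg_lift_monoid : monoid_morphism (alg_lift_def fg).
Proof.
split; first by rewrite alg_lift_pure !rmorph1 mulr1.
elim/(@algT_indP K A B)=> [a b|x x' IH IH'] y; last first.
  by rewrite mulrBl !raddfB /= IH IH' mulrBl.
elim/(@algT_indP K A B): y => [a' b'|x x' IH IH']; last first.
  by rewrite mulrBr !raddfB /= IH IH' mulrBr.
rewrite apureM !alg_lift_pure !rmorphM -!mulrA; congr (_ * _).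
by rewrite !mulrA fg.
Qed.

HB.instance Definition _ :=
  GRing.isMonoidMorphism.Build (algT A B) C (alg_lift_def fg) alg_lift_monoid.

Lemma alg_lift_scal c : alg_lift_def fg (scal c) = scal c.
Proof. by rewrite [LHS]alg_lift_pure rmorph1 mulr1 scal_morphism. Qed.

HB.instance Definition _ :=
  isScalMorphism.Build K (algT A B) C (alg_lift_def fg) alg_lift_scal.

Definition alg_lift : algHom (algT A B) C := alg_lift_def fg.

Lemma alg_liftE a b : alg_lift (apure a b) = f a * g b.
Proof. exact: alg_lift_pure. Qed.

End AlgLift.

Section TensorInjections.
Context {K : fieldType} {A B : pzAlgType K}.

Definition inl_fun (a : A) : algT A B := apure a 1.
Definition inr_fun (b : B) : algT A B := apure 1 b.

Lemma inl_zmod : zmod_morphism inl_fun.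
Proof.
by move=> a a'; apply: (addIr (inl_fun a')); rewrite /inl_fun -apureDl !subrK.
Qed.
Lemma inl_monoid : monoid_morphism inl_fun.
Proof. by split=> // a a'; rewrite /inl_fun apureM mulr1. Qed.
Lemma inl_scal c : inl_fun (scal c) = scal c.
Proof. by []. Qed.
HB.instance Definition _ :=
  GRing.isZmodMorphism.Build A (algT A B) inl_fun inl_zmod.
HB.instance Definition _ :=
  GRing.isMonoidMorphism.Build A (algT A B) inl_fun inl_monoid.
HB.instance Definition _ :=
  isScalMorphism.Build K A (algT A B) inl_fun inl_scal.
Definition alg_inl : algHom A (algT A B) := inl_fun.

Lemma inr_zmod : zmod_morphism inr_fun.
Proof.
by move=> a a'; apply: (addIr (inr_fun a')); rewrite /inr_fun -apureDr !subrK.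
Qed.
Lemma inr_monoid : monoid_morphism inr_fun.
Proof. by split=> // a a'; rewrite /inr_fun apureM mulr1. Qed.
Lemma inr_scal c : inr_fun (scal c) = scal c.
Proof. by rewrite /inr_fun -[scal c]mulr1 -apureS mulr1. Qed.
HB.instance Definition _ :=
  GRing.isZmodMorphism.Build B (algT A B) inr_fun inr_zmod.
HB.instance Definition _ :=
  GRing.isMonoidMorphism.Build B (algT A B) inr_fun inr_monoid.
HB.instance Definition _ :=
  isScalMorphism.Build K B (algT A B) inr_fun inr_scal.
Definition alg_inr : algHom B (algT A B) := inr_fun.

End TensorInjections.

Section TensorMap.
Context {K : fieldType} {A B A' B' : pzAlgType K}.
Variables (f : algHom A A') (g : algHom B B').

Lemma alg_map_comm a b :
  alg_comp (@alg_inl K A' B') f a * alg_comp (@alg_inr K A' B') g b =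
  alg_comp (@alg_inr K A' B') g b * alg_comp (@alg_inl K A' B') f a.
Proof. by rewrite [LHS]apureM [RHS]apureM !mulr1 !mul1r. Qed.

Definition alg_map : algHom (algT A B) (algT A' B') := alg_lift alg_map_comm.

Lemma alg_mapE a b : alg_map (apure a b) = apure (f a) (g b).
Proof. by rewrite [LHS]alg_liftE [LHS]apureM mulr1 mul1r. Qed.

End TensorMap.

Section MiddleSwap.
Context {K : fieldType}.
Variables (A B C D : pzAlgType K).

Let f : algHom (algT A B) (algT (algT A C) (algT B D)) :=
  alg_map alg_inl alg_inl.
Let g : algHom (algT C D) (algT (algT A C) (algT B D)) :=
  alg_map alg_inr alg_inr.

Lemma mid_swap_comm x y : f x * g y = g y * f x.
Proof.
elim/(@algT_indP K A B): x => [a b|x x' IH IH']; last first.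
  by rewrite rmorphB mulrBl mulrBr IH IH'.
elim/(@algT_indP K C D): y => [c d|x x' IH IH']; last first.
  by rewrite rmorphB mulrBl mulrBr IH IH'.
by rewrite /f /g !alg_mapE !apureM !mulr1 !mul1r.
Qed.

Definition mid_swap :
    algHom (algT (algT A B) (algT C D)) (algT (algT A C) (algT B D)) :=
  alg_lift mid_swap_comm.

Lemma mid_swapE a b c d :
  mid_swap (apure (apure a b) (apure c d)) = apure (apure a c) (apure b d).
Proof.
by rewrite [LHS]alg_liftE /f /g !alg_mapE !apureM !mulr1 !mul1r.
Qed.

End MiddleSwap.

Definition res (A B : pzRingType) (phi : {rmorphism B -> A})
  (M : lmodType A) : Type := M.

Section Restriction.
Context {A B : pzRingType} (phi : {rmorphism B -> A}) (M : lmodType A).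

HB.instance Definition _ := GRing.Zmodule.copy (res phi M) M.

Definition rscale (b : B) (m : res phi M) : res phi M := phi b *: (m : M).

Lemma rscaleA a b v : rscale a (rscale b v) = rscale (a * b) v.
Proof. by rewrite /rscale rmorphM scalerA. Qed.
Lemma rscale1 : left_id 1 rscale.
Proof. by move=> v; rewrite /rscale rmorph1 scale1r. Qed.
Lemma rscaleDr : right_distributive rscale +%R.
Proof. by move=> a u v; rewrite /rscale scalerDr. Qed.
Lemma rscaleDl v : {morph rscale^~ v : a b / a + b}.
Proof. by move=> a b; rewrite /rscale rmorphD scalerDl. Qed.

HB.instance Definition _ := GRing.Zmodule_isLmodule.Build B (res phi M)
  rscaleA rscale1 rscaleDr rscaleDl.

End Restriction.

(* A (x)_B M, where A is a right B-module through phi *)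
Definition ind (A B : pzRingType) (phi : {rmorphism B -> A})
    (M : lmodType B) : Type :=
  tensor (fun (b : B) (a : A) => a * phi b) (fun (b : B) (m : M) => b *: m).

Section Induction.
Context {A B : pzRingType} (phi : {rmorphism B -> A}) (M : lmodType B).

HB.instance Definition _ := GRing.Zmodule.on (ind phi M).

Definition ipure (a : A) (m : M) : ind phi M := tpure a m.

Lemma iscale_bal (a : A) :
  balanced (fun (b : B) (a : A) => a * phi b) (fun (b : B) (m : M) => b *: m)
    (fun a' m => ipure (a * a') m).
Proof.
split.
- by move=> v v' w; rewrite mulrDr [LHS]tpureDl.
- by move=> v w w'; rewrite [LHS]tpureDr.
- by move=> b v w; rewrite mulrA [LHS](tpureS b).
Qed.

Definition iscale (a : A) : ind phi M -> ind phi M := tlift (iscale_bal a).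

Lemma iscaleE a a' m : iscale a (ipure a' m) = ipure (a * a') m.
Proof. exact: tliftE. Qed.

Lemma ind_indP (P : ind phi M -> Prop) :
  (forall a m, P (ipure a m)) -> (forall x y, P x -> P y -> P (x - y)) ->
  forall x, P x.
Proof. exact: tensor_indP. Qed.

Lemma iscaleB a : {morph iscale a : x y / x - y}.
Proof. by move=> x y; rewrite /iscale raddfB. Qed.

Lemma iscaleA a b v : iscale a (iscale b v) = iscale (a * b) v.
Proof.
elim/ind_indP: v => [c m|x y IHx IHy]; first by rewrite !iscaleE mulrA.
by rewrite !iscaleB IHx IHy.
Qed.

Lemma iscale1 : left_id 1 iscale.
Proof.
elim/ind_indP=> [c m|x y IHx IHy]; first by rewrite iscaleE mul1r.
by rewrite iscaleB IHx IHy.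
Qed.

Lemma iscaleDr : right_distributive iscale +%R.
Proof. by move=> a u v; rewrite /iscale raddfD. Qed.

Lemma iscaleDl v : {morph iscale^~ v : a b / a + b}.
Proof.
move=> a b; elim/ind_indP: v => [c m|x y IHx IHy].
  by rewrite !iscaleE mulrDl [LHS]tpureDl.
by rewrite !iscaleB IHx IHy opprD addrACA.
Qed.

HB.instance Definition _ := GRing.Zmodule_isLmodule.Build A (ind phi M)
  iscaleA iscale1 iscaleDr iscaleDl.

Lemma ind_scaleE a b m : a *: ipure b m = ipure (a * b) m.
Proof. exact: iscaleE. Qed.

End Induction.

Definition dsum (A : pzRingType) (I : finType) (M : I -> lmodType A) : Type :=
  forall i, M i.

Section DirectSum.
Context {A : pzRingType} {I : finType} (M : I -> lmodType A).
HB.instance Definition _ := gen_eqMixin (dsum M).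
HB.instance Definition _ := gen_choiceMixin (dsum M).

Definition ds_zero : dsum M := fun i => 0.
Definition ds_opp (u : dsum M) : dsum M := fun i => - u i.
Definition ds_add (u v : dsum M) : dsum M := fun i => u i + v i.
Definition ds_scale (a : A) (u : dsum M) : dsum M := fun i => a *: u i.

Lemma ds_addA : associative ds_add.
Proof. by move=> u v w; apply: functional_extensionality_dep => i; exact: addrA. Qed.
Lemma ds_addC : commutative ds_add.
Proof. by move=> u v; apply: functional_extensionality_dep => i; exact: addrC. Qed.
Lemma ds_add0 : left_id ds_zero ds_add.
Proof. by move=> u; apply: functional_extensionality_dep => i; exact: add0r. Qed.
Lemma ds_addN : left_inverse ds_zero ds_opp ds_add.
Proof. by move=> u; apply: functional_extensionality_dep => i; exact: addNr. Qed.

HB.instance Definition _ :=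
  GRing.isZmodule.Build (dsum M) ds_addA ds_addC ds_add0 ds_addN.

Lemma ds_scaleA a b u : ds_scale a (ds_scale b u) = ds_scale (a * b) u.
Proof. by apply: functional_extensionality_dep => i; exact: scalerA. Qed.
Lemma ds_scale1 : left_id 1 ds_scale.
Proof. by move=> u; apply: functional_extensionality_dep => i; exact: scale1r. Qed.
Lemma ds_scaleDr : right_distributive ds_scale +%R.
Proof. by move=> a u v; apply: functional_extensionality_dep => i; exact: scalerDr. Qed.
Lemma ds_scaleDl u : {morph ds_scale^~ u : a b / a + b}.
Proof. by move=> a b; apply: functional_extensionality_dep => i; exact: scalerDl. Qed.

HB.instance Definition _ := GRing.Zmodule_isLmodule.Build A (dsum M)
  ds_scaleA ds_scale1 ds_scaleDr ds_scaleDl.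

End DirectSum.

(* The product of MathComp is (s * t) x = t (s x); pcomp is composition of
   functions: pcomp s t x = s (t x). *)
Definition pcomp (N : nat) (s t : 'S_N) : 'S_N := (t * s)%g.

Lemma pcompE N (s t : 'S_N) x : pcomp s t x = s (t x).
Proof. exact: permM. Qed.

Section SymmetricGroup.
Local Open Scope nat_scope.
Variable N : nat.
Implicit Types (i j : 'I_N.-1) (w a s t : 'S_N).

Lemma lo_subproof i : i < N.
Proof. by case: i => i /= H; apply: leq_trans H (leq_pred N). Qed.
Lemma hi_subproof i : i.+1 < N.
Proof. by case: i => i /= H; rewrite -ltn_predRL. Qed.

Definition lo i : 'I_N := Ordinal (lo_subproof i).
Definition hi i : 'I_N := Ordinal (hi_subproof i).

(* Everything is indexed from 0: i : 'I_N.-1 stands for the index i + 1 of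
   [N - 1], and sref i exchanges the ordinals i and i + 1 of 'I_N. *)
Definition sref i : 'S_N := tperm (lo i) (hi i).

Definition wprod (u : seq 'I_N.-1) : 'S_N :=
  foldr (fun i => pcomp (sref i)) 1%g u.

Definition has_word w (r : nat) : bool :=
  [exists u : r.-tuple 'I_N.-1, wprod u == w].

Definition ninv a : nat :=
  #|[set p : 'I_N * 'I_N | (p.1 < p.2) && (a p.2 < a p.1)]|.

Lemma val_sref i (x : 'I_N) :
  sref i x = (if x == i :> nat then i.+1 else if x == i.+1 :> nat then (i : nat) else x)
  :> nat.
Proof.
rewrite /sref; case: tpermP => [->|->|/eqP xl /eqP xh] /=.
- by rewrite eqxx.
- by rewrite gtn_eqF // eqxx.
- by rewrite -[x == i :> nat]/(x == lo i) (negPf xl) -[x == _ :> nat]/(x == hi i)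
             (negPf xh).
Qed.

Lemma sref_lo i : sref i (lo i) = hi i. Proof. exact: tpermL. Qed.
Lemma sref_hi i : sref i (hi i) = lo i. Proof. exact: tpermR. Qed.
Lemma srefK i : involutive (sref i). Proof. exact: tpermK. Qed.
Lemma sref2 i : (sref i * sref i = 1)%g. Proof. exact: tperm2. Qed.
Lemma srefV i : ((sref i)^-1 = sref i)%g. Proof. exact: tpermV. Qed.

Lemma sref_mono i (x y : 'I_N) :
  x < y -> (x, y) != (lo i, hi i) -> sref i x < sref i y.
Proof.
move=> xy; rewrite xpair_eqE -!val_eqE /= !val_sref.
by do ![case: eqP] => //=; lia.
Qed.

Lemma ninv_up i a : a (lo i) < a (hi i) -> ninv (sref i * a)%g = (ninv a).+1.
Proof.
move=> lt_a; rewrite /ninv [LHS](cardsD1 (lo i, hi i)) inE /= !permM.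
rewrite sref_lo sref_hi lt_a leqnn add1n; congr _.+1.
pose f (p : 'I_N * 'I_N) := (sref i p.1, sref i p.2).
have fK : involutive f by case=> x y; rewrite /f /= !srefK.
rewrite -[RHS](card_imset _ (inv_inj fK)); apply: eq_card => -[x y].
rewrite (can2_imset_pre _ fK fK) !inE /= !permM.
apply/andP/andP => [[ne /andP[xy ->]]|[xy lt]].
  by split=> //; apply: sref_mono.
have ne : (x, y) != (lo i, hi i).
  apply: contraTneq xy => -[-> ->]; rewrite sref_lo sref_hi /= -leqNgt; exact: leqnSn.
split=> //; rewrite lt andbT -(srefK i x) -(srefK i y).
apply: sref_mono xy _; apply: contraTneq lt => -[-> ->].
by rewrite -leqNgt ltnW.
Qed.

Lemma ninv_down i a : a (hi i) < a (lo i) -> ninv a = (ninv (sref i * a)%g).+1.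
Proof.
move=> lt_a; rewrite -(@ninv_up i) ?permM ?sref_lo ?sref_hi //.
by rewrite mulgA sref2 mul1g.
Qed.

Lemma ninv1 : ninv 1%g = 0%N.
Proof.
apply/eqP; rewrite cards_eq0; apply/eqP/setP => -[x y]; rewrite !inE /= !perm1.
by case: ltngtP.
Qed.

Lemma ninv_sref i : ninv (sref i) = 1.
Proof. by rewrite -[sref i]mulg1 ninv_up ?ninv1 // !perm1. Qed.

Lemma lo_hi_neq i a : a (lo i) != a (hi i) :> nat.
Proof. by rewrite val_eqE (inj_eq perm_inj) -val_eqE /= ltn_eqF. Qed.

Lemma ninv_sref_le i a : ninv (sref i * a)%g <= (ninv a).+1.
Proof.
case: (ltngtP (a (lo i)) (a (hi i))) => [lt|lt|/eqP].
- by rewrite ninv_up.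
- by rewrite [X in _ <= X.+1](ninv_down lt) leqW.
- by rewrite (negPf (lo_hi_neq i a)).
Qed.

Lemma wprodV_ninv u : ninv (wprod u)^-1%g <= size u.
Proof.
elim: u => [|i u IH] /=; first by rewrite invg1 ninv1.
by rewrite /pcomp invMg srefV; apply: leq_trans (ninv_sref_le _ _) _.
Qed.

Lemma increasing_ge a :
  (forall i, a (lo i) < a (hi i)) -> forall x y : 'I_N, x < y -> a x < a y.
Proof.
move=> inc x [y yN] /= xy; elim: y yN xy => // y IH yN.
have yi : y < N.-1 by rewrite ltn_predRL.
have -> : Ordinal yN = hi (Ordinal yi) by apply: val_inj.
rewrite ltnS leq_eqVlt => /predU1P[xy|xy].
  by have -> : x = lo (Ordinal yi) by apply: val_inj.
apply: ltn_trans (inc (Ordinal yi)).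
have -> : lo (Ordinal yi) = Ordinal (ltnW yN) by apply: val_inj.
exact: IH.
Qed.

Lemma increasing_le a : (forall x y : 'I_N, x < y -> a x < a y) ->
  forall x : 'I_N, x <= a x.
Proof.
move=> inc [x xN]; elim: x xN => // x IH xN /=.
apply: leq_ltn_trans (IH (ltnW xN)) _; exact: inc.
Qed.

Lemma increasing1 a : (forall x y : 'I_N, x < y -> a x < a y) -> a = 1%g.
Proof.
move=> inc; have incV (x y : 'I_N) : x < y -> (a^-1 x < a^-1 y)%g.
  move=> xy; rewrite ltnNge leq_eqVlt; apply/negP => /predU1P[/val_inj/perm_inj E|/inc].
    by rewrite E ltnn in xy.
  by rewrite !permKV ltnNge ltnW.
apply/permP => x; rewrite perm1; apply/val_inj/eqP.
rewrite eqn_leq (increasing_le inc) andbT.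
by have := increasing_le incV (a x); rewrite permK.
Qed.

Lemma has_word_ninv w : has_word w (ninv w^-1%g).
Proof.
move En : (ninv _) => n; elim: n w En => [|n IH] w En.
  apply/existsP; exists [tuple]; rewrite /= eq_sym -eq_invg1.
  apply/eqP/increasing1/increasing_ge => i; rewrite ltn_neqAle lo_hi_neq leqNgt.
  by apply/negP => /ninv_down; rewrite En.
case: (pickP (fun i => w^-1 (hi i) < w^-1 (lo i))%g) => [i lt_i|inc].
  have := ninv_down lt_i; rewrite En => -[/esym E].
  have := IH (w * sref i)%g; rewrite invMg srefV => /(_ E)/existsP[u /eqP Eu].
  apply/existsP; exists [tuple of i :: u].
  by rewrite /= Eu /pcomp -mulgA sref2 mulg1.
move: En; have -> : w^-1%g = 1%g; last by rewrite ninv1.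
apply/increasing1/increasing_ge => i; rewrite ltn_neqAle lo_hi_neq leqNgt.
by rewrite inc.
Qed.

Lemma has_word_ex w : exists r, has_word w r.
Proof. by exists (ninv w^-1%g); apply: has_word_ninv. Qed.

Definition coxlen w : nat := ex_minn (has_word_ex w).

Definition DesL w : {set 'I_N.-1} :=
  [set i | (coxlen (pcomp (sref i) w) < coxlen w)%N].

Definition leL s t : bool :=
  [exists g : 'S_N, (t == pcomp g s) && (coxlen t == coxlen g + coxlen s)%N].

Lemma coxlenE w : coxlen w = ninv w^-1%g.
Proof.
rewrite /coxlen; case: ex_minnP => r /existsP[u /eqP <-] min_r.
apply/eqP; rewrite eqn_leq; apply/andP; split; last first.
  by rewrite -[X in _ <= X](size_tuple u) wprodV_ninv.
apply: min_r; exact: has_word_ninv.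
Qed.

Lemma DesLE i w : (i \in DesL w) = ((w^-1 (hi i) < w^-1 (lo i))%g).
Proof.
rewrite inE !coxlenE /pcomp invMg srefV.
case: (ltngtP (w^-1 (lo i))%g (w^-1 (hi i))%g) => [lt|lt|/eqP].
- by rewrite ninv_up // ltnNge leqnSn.
- by rewrite [X in _ < X](ninv_down lt) ltnSn.
- by rewrite (negPf (lo_hi_neq i w^-1%g)).
Qed.

Lemma wprod_cat u v : wprod (u ++ v) = pcomp (wprod u) (wprod v).
Proof.
elim: u => [|i u IH] /=; first by rewrite /pcomp mulg1.
by rewrite IH /pcomp mulgA.
Qed.

Lemma coxlen_le u : coxlen (wprod u) <= size u.
Proof. by rewrite coxlenE wprodV_ninv. Qed.

Lemma coxlen_word w : exists2 u, wprod u = w & size u = coxlen w.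
Proof.
have /existsP[u /eqP Eu] := has_word_ninv w.
by exists u; rewrite ?size_tuple ?coxlenE.
Qed.

Lemma coxlenM s t : coxlen (pcomp s t) <= coxlen s + coxlen t.
Proof.
have [u <- <-] := coxlen_word s; have [v <- <-] := coxlen_word t.
by rewrite -wprod_cat -size_cat coxlen_le.
Qed.

Lemma leL_refl w : leL w w.
Proof.
apply/existsP; exists 1%g; rewrite /pcomp mulg1 eqxx /=.
by rewrite [coxlen 1%g]coxlenE invg1 ninv1.
Qed.

Lemma leL_trans t s w : leL s t -> leL t w -> leL s w.
Proof.
move=> /existsP[g /andP[/eqP-> /eqP Eg]] /existsP[h /andP[/eqP-> /eqP Eh]].
apply/existsP; exists (pcomp h g); apply/andP; split.
  by rewrite /pcomp mulgA.
have le1 := coxlenM h g.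
have := coxlenM (pcomp h g) s.
have -> : pcomp (pcomp h g) s = pcomp h (pcomp g s) by rewrite /pcomp mulgA.
rewrite {}Eh {}Eg => le2; apply/eqP; lia.
Qed.

Lemma leL_sref i w : i \notin DesL w -> leL w (pcomp (sref i) w).
Proof.
rewrite DesLE -leqNgt leq_eqVlt (negPf (lo_hi_neq i w^-1%g)) /= => lt.
apply/existsP; exists (sref i); rewrite eqxx !coxlenE /pcomp invMg srefV ninv_up //.
by rewrite ninv_sref add1n eqxx.
Qed.

Definition hstep i w := if i \in DesL w then w else pcomp (sref i) w.

Lemma leL_hstep i w : leL w (hstep i w).
Proof. by rewrite /hstep; case: ifPn => [_|/leL_sref //]; apply: leL_refl. Qed.

Let vstep i a := if a (hi i) < a (lo i) then a else (sref i * a)%g.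

Lemma hstepV i w : ((hstep i w)^-1 = vstep i w^-1)%g.
Proof. by rewrite /hstep /vstep DesLE; case: ifP; rewrite // /pcomp invMg srefV. Qed.

Lemma hstep_idem i w : hstep i (hstep i w) = hstep i w.
Proof.
apply: invg_inj; rewrite !hstepV; set a := (w^-1)%g.
rewrite {2 3}/vstep; case: ifPn => [lt|].
  by rewrite /vstep lt.
rewrite -leqNgt leq_eqVlt (negPf (lo_hi_neq i a)) /= => lt.
by rewrite /vstep !permM sref_lo sref_hi lt.
Qed.

Lemma sref_comm i j : (i.+1 < j)%N -> (sref i * sref j = sref j * sref i)%g.
Proof.
move=> ij; apply/permP => x; apply: val_inj; rewrite !permM /= !val_sref.
by do ![case: eqP] => //=; lia.
Qed.

Lemma sref_fix i (x : 'I_N) : x != i :> nat -> x != i.+1 :> nat -> sref i x = x.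
Proof. by move=> /negPf h1 /negPf h2; apply: val_inj; rewrite /= val_sref h1 h2. Qed.

Lemma hstep_comm i j w : (i.+1 < j)%N ->
  hstep i (hstep j w) = hstep j (hstep i w).
Proof.
move=> ij; apply: invg_inj; rewrite !hstepV; set a := (w^-1)%g.
have Ejl : sref i (lo j) = lo j by apply: sref_fix => /=; apply/eqP; lia.
have Ejh : sref i (hi j) = hi j by apply: sref_fix => /=; apply/eqP; lia.
have Eil : sref j (lo i) = lo i by apply: sref_fix => /=; apply/eqP; lia.
have Eih : sref j (hi i) = hi i by apply: sref_fix => /=; apply/eqP; lia.
rewrite /vstep; case: (boolP (a (hi i) < a (lo i))) => Hi;
  case: (boolP (a (hi j) < a (lo j))) => Hj;
  rewrite ?permM ?Ejl ?Ejh ?Eil ?Eih ?(negPf Hi) ?(negPf Hj) ?Hi ?Hj //.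
by rewrite !mulgA sref_comm.
Qed.

Lemma sref_braid i j : j = i.+1 :> nat ->
  (sref i * sref j * sref i = sref j * sref i * sref j)%g.
Proof.
move=> ij; apply/permP => x; apply: val_inj; rewrite !permM /= !val_sref.
by rewrite ij; do ![case: eqP] => //=; lia.
Qed.

Lemma hstep_braid i j w : j = i.+1 :> nat ->
  hstep i (hstep j (hstep i w)) = hstep j (hstep i (hstep j w)).
Proof.
move=> ij; apply: invg_inj; rewrite !hstepV; set a := (w^-1)%g.
have Ejl : lo j = hi i by apply: val_inj; rewrite /= ij.
have E1 : sref i (hi j) = hi j by apply: sref_fix => /=; apply/eqP; lia.
have E2 : sref j (lo i) = lo i by apply: sref_fix => /=; apply/eqP; lia.
have E3 : sref j (hi i) = hi j by rewrite -Ejl sref_lo.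
have E4 : sref j (hi j) = hi i by rewrite -Ejl sref_hi.
have n1 := lo_hi_neq i a; have n2 := lo_hi_neq j a; rewrite Ejl in n2.
have n3 : a (lo i) != a (hi j) :> nat.
  by rewrite val_eqE (inj_eq perm_inj) -val_eqE /= ij; apply/eqP; lia.
rewrite /vstep Ejl.
case: (ltngtP (a (hi i)) (a (lo i))) n1 => // H1 _;
case: (ltngtP (a (hi j)) (a (hi i))) n2 => // H2 _;
case: (ltngtP (a (hi j)) (a (lo i))) n3 => // H3 _;
  try (by move: H1 H2 H3; lia);
  repeat (rewrite ?permM ?sref_lo ?sref_hi ?Ejl ?E1 ?E2 ?E3 ?E4
    ?H1 ?H2 ?H3 ?(ltnNge (a (lo i))) ?(ltnNge (a (hi i))) ?(ltnNge (a (hi j)))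
    ?(ltnW H1) ?(ltnW H2) ?(ltnW H3) /= ) => //.
by rewrite !mulgA sref_braid.
Qed.

End SymmetricGroup.

Section Hecke.
Variables (K : fieldType) (N : nat).

Inductive hecke_rel : aterm K 'I_N.-1 -> aterm K 'I_N.-1 -> Prop :=
  | hecke_idem (i : 'I_N.-1) :
      hecke_rel (AMul (AGen K i) (AGen K i)) (AGen K i)
  | hecke_braid (i j : 'I_N.-1) : j = i.+1 :> nat ->
      hecke_rel (AMul (AGen K i) (AMul (AGen K j) (AGen K i)))
                (AMul (AGen K j) (AMul (AGen K i) (AGen K j)))
  | hecke_comm (i j : 'I_N.-1) : (i.+1 < j)%N ->
      hecke_rel (AMul (AGen K i) (AGen K j)) (AMul (AGen K j) (AGen K i)).

Definition hecke : Type := presAlg hecke_rel.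
HB.instance Definition _ := PzAlgebra.on hecke.

Definition hpi (i : 'I_N.-1) : hecke := pgen hecke_rel i.

Lemma hpi_idem i : hpi i * hpi i = hpi i.
Proof. by rewrite [LHS]pmulE; apply/pcls_rel/hecke_idem. Qed.

Lemma hpi_comm (i j : 'I_N.-1) : (i.+1 < j)%N -> hpi i * hpi j = hpi j * hpi i.
Proof. by move=> ij; rewrite [LHS]pmulE [RHS]pmulE; apply/pcls_rel/hecke_comm. Qed.

Lemma hpi_braid (i j : 'I_N.-1) : j = i.+1 :> nat ->
  hpi i * (hpi j * hpi i) = hpi j * (hpi i * hpi j).
Proof.
move=> ij; rewrite [hpi j * _]pmulE [LHS]pmulE.
by rewrite [hpi i * _]pmulE [RHS]pmulE; apply/pcls_rel/hecke_braid.
Qed.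

Lemma hecke_rel_oact (W : Type) (V : lmodType K) (B : 'I_N.-1 -> {linear V -> V})
    (ins : W -> V) (P : W -> Prop) (step : 'I_N.-1 -> W -> W) :
  (forall i w, P w -> P (step i w)) ->
  (forall i w, P w -> B i (ins w) = ins (step i w)) ->
  (forall i w, step i (step i w) = step i w) ->
  (forall (i j : 'I_N.-1) w, j = i.+1 :> nat ->
    step i (step j (step i w)) = step j (step i (step j w))) ->
  (forall (i j : 'I_N.-1) w, (i.+1 < j)%N ->
    step i (step j w) = step j (step i w)) ->
  forall s t, hecke_rel s t -> forall w, P w ->
  oact B s (ins w) = oact B t (ins w).
Proof.
move=> Ps BE Hi Hb Hc s t [i|i j ij|i j ij] w Pw /=.
- by rewrite !BE ?Hi //; auto.
- by rewrite !BE ?(Hb _ _ _ ij) //; auto.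
- by rewrite !BE ?(Hc _ _ _ ij) //; auto.
Qed.

End Hecke.

Arguments hpi {K N} i.

Section HeckeShift.
Variables (K : fieldType) (c a N : nat).

Lemma shift_subproof (le_N : (c + a <= N)%N) (i : 'I_a.-1) : (c + i < N.-1)%N.
Proof. by case: i => i /=; lia. Qed.

Definition shift_ord (le_N : (c + a <= N)%N) (i : 'I_a.-1) : 'I_N.-1 :=
  Ordinal (shift_subproof le_N i).

Variable le_N : (c + a <= N)%N.

Lemma shift_rel (s t : aterm K 'I_a.-1) : hecke_rel s t ->
  aeval (fun i => hpi (shift_ord le_N i) : hecke K N) s =
  aeval (fun i => hpi (shift_ord le_N i) : hecke K N) t.
Proof.
case=> [i|i j ij|i j ij] /=.
- exact: hpi_idem.
- by apply: hpi_braid; rewrite /= ij addnS.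
- by apply: hpi_comm; rewrite /= -addnS ltn_add2l.
Qed.

Definition hecke_shift : algHom (hecke K a) (hecke K N) := plift shift_rel.

Lemma hecke_shift_pi i : hecke_shift (hpi i) = hpi (shift_ord le_N i).
Proof. exact: plift_gen. Qed.

End HeckeShift.

Section Parabolic.
Variables (K : fieldType) (a b N : nat) (eN : (a + b = N)%N).

Lemma par_subproofl : (0 + a <= N)%N.
Proof. by rewrite -eN leq_addr. Qed.
Lemma par_subproofr : (a + b <= N)%N.
Proof. by rewrite eN. Qed.

Let f := @hecke_shift K 0 a N par_subproofl.
Let g := @hecke_shift K a b N par_subproofr.

Lemma par_comm x y : f x * g y = g y * f x.
Proof.
elim/pindP: x; elim=> [i|c|s IHs t IHt|s IHs t IHt].
- elim/pindP: y; elim=> [j|c|s IHs t IHt|s IHs t IHt].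
  + rewrite !hecke_shift_pi; apply: hpi_comm => /=.
    by case: i j => i Hi [j Hj] /=; lia.
  + by rewrite pclsS scal_morphism scalC.
  + by rewrite pclsD rmorphD mulrDl mulrDr IHs IHt.
  + by rewrite pclsM rmorphM mulrA IHs -!mulrA IHt.
- by rewrite pclsS scal_morphism scalC.
- by rewrite pclsD rmorphD mulrDl mulrDr IHs IHt.
- by rewrite pclsM rmorphM -mulrA IHt mulrA IHs mulrA.
Qed.

(* H_a(0) (x) H_b(0) -> H_N(0), where N = a + b:
   pi_i (x) 1 |-> pi_i and 1 (x) pi_j |-> pi_(a+j) *)
Definition par : algHom (algT (hecke K a) (hecke K b)) (hecke K N) :=
  alg_lift par_comm.

Lemma par_inl i : par (apure (hpi i) 1) = hpi (shift_ord par_subproofl i).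
Proof. by rewrite [LHS]alg_liftE rmorph1 mulr1; exact: hecke_shift_pi. Qed.

Lemma par_inr j : par (apure 1 (hpi j)) = hpi (shift_ord par_subproofr j).
Proof. by rewrite [LHS]alg_liftE rmorph1 mul1r; exact: hecke_shift_pi. Qed.

End Parabolic.

Section IntervalModule.
Variables (K : fieldType) (N : nat) (sigma rho : 'S_N).

Definition itvL : finType := {g : 'S_N | leL sigma g && leL g rho}.

(* pi_i . g, with None standing for the zero vector *)
Definition itv_act (i : 'I_N.-1) (g : itvL) : option itvL :=
  if i \in DesL (val g) then Some g else insub (pcomp (sref i) (val g)).

Definition Bmod : Type := {ffun itvL -> K^o}.
HB.instance Definition _ := GRing.Zmodule.on Bmod.

Local Notation V := {ffun itvL -> K^o}.

Definition itv_vec (g : itvL) : V := [ffun h => (h == g)%:R].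
Definition itv_ovec (o : option itvL) : V :=
  if o is Some g then itv_vec g else 0.

Definition Bact_fun (i : 'I_N.-1) (v : V) : V :=
  \sum_g (v g : K) *: itv_ovec (itv_act i g).

Lemma Bact_linear i : linear (Bact_fun i).
Proof.
move=> c u v; rewrite /Bact_fun scaler_sumr -big_split /=; apply: eq_bigr => g _.
by rewrite !ffunE scalerDl scalerA.
Qed.

HB.instance Definition _ i := GRing.isLinear.Build K V V _ (Bact_fun i)
  (Bact_linear i).

Definition Bact (i : 'I_N.-1) : {linear V -> V} := Bact_fun i.

Lemma Bact_vec i g : Bact i (itv_vec g) = itv_ovec (itv_act i g).
Proof.
rewrite /= /Bact_fun (bigD1 g) //= ffunE eqxx scale1r big1 ?addr0 // => h /negPf hg.
by rewrite ffunE hg scale0r.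
Qed.

Lemma Bact_ovec i o : Bact i (itv_ovec o) = itv_ovec (obind (itv_act i) o).
Proof. by case: o => [g|]; [exact: Bact_vec|exact: raddf0]. Qed.

Lemma itv_vec_sum (v : V) : v = \sum_g (v g : K) *: itv_vec g.
Proof.
apply/ffunP => h; rewrite sum_ffunE (bigD1 h) //= big1 ?addr0 => [|g /negPf gh].
  by rewrite !ffunE eqxx [RHS]mulr1.
by rewrite !ffunE eq_sym gh [LHS]mulr0.
Qed.

Lemma itv_ext (f g : {linear V -> V}) :
  (forall h, f (itv_vec h) = g (itv_vec h)) -> f =1 g.
Proof.
move=> fg v; rewrite (itv_vec_sum v) !raddf_sum; apply: eq_bigr => h _.
by rewrite /= !linearZ /= fg.
Qed.

Lemma itv_actE i g : itv_act i g = insub (hstep i (val g)).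
Proof. by rewrite /itv_act /hstep; case: ifP => // _; rewrite valK. Qed.

Lemma obind_itv_act i w : leL sigma w ->
  obind (itv_act i) (insub w) = insub (hstep i w).
Proof.
move=> sw; case: insubP => [g _ Eg|] /=; first by rewrite itv_actE Eg.
rewrite sw /= => wr; rewrite insubF // andbC.
apply/negP => /andP[hr _]; move/negP: wr; apply.
exact: leL_trans (leL_hstep i w) hr.
Qed.

Lemma Bact_insub i w : leL sigma w ->
  Bact i (itv_ovec (insub w)) = itv_ovec (insub (hstep i w)).
Proof. by move=> sw; rewrite Bact_ovec obind_itv_act. Qed.

Lemma Bact_rel s t : @hecke_rel K N s t -> oact Bact s =1 oact Bact t.
Proof.
have ext (f g : V -> V) : linear f -> linear g ->
    (forall h, f (itv_vec h) = g (itv_vec h)) -> f =1 g.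
  move=> lf lg; pose F := GRing.isLinear.Build K V V _ f lf.
  pose G := GRing.isLinear.Build K V V _ g lg.
  pose f' : {linear V -> V} := HB.pack f F.
  pose g' : {linear V -> V} := HB.pack g G.
  exact: (@itv_ext f' g').
have lin u : linear (oact Bact u) by move=> c x y; rewrite oactD oactZ.
move=> st; apply: ext => // h.
have h0 : leL sigma (val h) by case/andP: (valP h).
have -> : itv_vec h = itv_ovec (insub (val h)) by rewrite valK.
apply: (@hecke_rel_oact K N 'S_N _ Bact (fun w => itv_ovec (insub w)) (leL sigma)
  (@hstep N)) st (val h) h0.
- by move=> i w sw; exact: leL_trans sw (leL_hstep i w).
- exact: Bact_insub.
- exact: hstep_idem.
- exact: hstep_braid.
- exact: hstep_comm.
Qed.

Definition Bscale (x : hecke K N) (v : Bmod) : Bmod := pact Bact x v.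

Lemma BscaleA x y v : Bscale x (Bscale y v) = Bscale (x * y) v.
Proof. exact: (pactA Bact_rel). Qed.
Lemma Bscale1 : left_id 1 Bscale.
Proof. exact: (pact1 Bact_rel). Qed.
Lemma BscaleDr : right_distributive Bscale +%R.
Proof. exact: pactDr. Qed.
Lemma BscaleDl v : {morph Bscale^~ v : x y / x + y}.
Proof. exact: (pactDl Bact_rel). Qed.

HB.instance Definition _ := GRing.Zmodule_isLmodule.Build (hecke K N) Bmod
  BscaleA Bscale1 BscaleDr BscaleDl.

Definition Bvec (g : itvL) : Bmod := itv_vec g.

Lemma Bmod_scale_pi i g : hpi i *: Bvec g =
  if i \in DesL (val g) then Bvec g
  else if insub (pcomp (sref i) (val g)) is Some h then Bvec h else 0.
Proof.
rewrite [LHS](pact_cls Bact_rel) [LHS]Bact_vec /itv_act.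
by case: ifP => // _; case: insub.
Qed.

Lemma Bmod_scale_scal c (v : Bmod) :
  (scal c : hecke K N) *: v = c *: (v : {ffun itvL -> K^o}).
Proof. exact: (pact_cls Bact_rel (AScal _ c)). Qed.

End IntervalModule.

Definition indprod (K : fieldType) (a b : nat) (M : lmodType (hecke K a))
    (L : lmodType (hecke K b)) : lmodType (hecke K (a + b)) :=
  ind (par K (erefl (a + b)%N)) (modT M L).

Definition mackey_index (m n k : nat) : finType :=
  {p : 'I_m.+1 * 'I_n.+1 | (p.1 + p.2 == k)%N}.

Section MackeyIndex.
Context {m n k : nat} (p : mackey_index m n k).
Definition mt : nat := (val p).1.
Definition ms : nat := (val p).2.

Lemma mt_m : (mt + (m - mt) = m)%N.
Proof. by rewrite /mt; case: (val p).1 => t /= lt; rewrite subnKC. Qed.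
Lemma ms_n : (ms + (n - ms) = n)%N.
Proof. by rewrite /ms; case: (val p).2 => s /= ls; rewrite subnKC. Qed.
Lemma mts_k : (mt + ms = k)%N.
Proof. exact/eqP/(valP p). Qed.
Lemma mts_mnk : ((m - mt) + (n - ms) = m + n - k)%N.
Proof. have := mt_m; have := ms_n; have := mts_k; lia. Qed.
End MackeyIndex.

(* The functor T_(t,s): the same vector space, on which a (x) b (x) c (x) d acts
   as a (x) c (x) b (x) d; it sends M1 (x) M2 (x) N1 (x) N2 to
   M1 (x) N1 (x) M2 (x) N2. *)
Definition Tswap (K : fieldType) (m n t s : nat)
    (M : lmodType (algT (algT (hecke K t) (hecke K (m - t)))
                        (algT (hecke K s) (hecke K (n - s))))) :
    lmodType (algT (algT (hecke K t) (hecke K s))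
                   (algT (hecke K (m - t)) (hecke K (n - s)))) :=
  res (mid_swap (hecke K t) (hecke K s) (hecke K (m - t)) (hecke K (n - s))) M.

(* Main.v *)
From HB Require Import structures.
Require Import Defs.
From mathcomp Require Import all_boot all_algebra all_fingroup reals complex.
From mathcomp Require Import boolp zify.

Set Implicit Arguments.
Unset Strict Implicit.
Unset Printing Implicit Defensive.

Import GRing.Theory.
Local Open Scope ring_scope.

(** The formula is an instance of a Mackey formula for 0-Hecke algebras, [mackey],
    about arbitrary modules M over H_m(0) and L over H_n(0).

    Put N = m + n. A minimal representative v of a left coset of S_m x S_n in
    S_N is determined by the word of length N whose j-th letter tells from which
    of the two blocks the value j comes ([false] for the first, [true] for the
    second). Let T_v be the product of the generators along a reduced word of v;
    it is built here directly from the word, as [coset_elt]. For every i one has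
    pi_i T_v = T_v' h ([hgen_coset_elt]), where either v' is s_i v or v and
    h = 1, or v' = v and h is a generator of the parabolic subalgebra
    H_m(0) (x) H_n(0). On words, v' arises from v by exchanging at most the
    letters i and i + 1. For i different from k the exchange stays on one side
    of the cut after k letters, hence left multiplication by H_k(0) (x) H_(N-k)(0)
    preserves the span of the T_v h with v in a fixed double coset. This is why
    the restriction is a direct sum and not only filtered. The double coset is
    given by the number t of letters of the first block before the cut.

    Fix t and let d be the minimal element of its double coset, whose word is
    sorted on both sides of the cut. Cutting a word w of the double coset at k
    gives words w1 and w2 with T_w = (T_w1 (x) T_w2) T_d ([coset_elt_split]), and
    pi_i T_d = T_d pi_j matches the four tensor factors in the order prescribed
    by the functor T_(t,s) ([glue_funZ]). So y (x) x |-> y T_d (x) x is a well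
    defined map from the summand of t to the induction product ([glue]), and
    T_w (x) x |-> (T_w1 (x) T_w2) (x) x is its inverse on the part of t
    ([to_piece]).

    The second map is well defined only if the induced module is the direct sum
    of the spaces T_v (x) X over all representatives v, where X = M (x) L. This
    freeness is proved by making the space of functions from words to X into a
    module over H_N(0), with the action that the formula for pi_i T_v dictates
    ([shmod]). The relations are checked letter by letter, and the induced
    module maps to this one injectively ([to_sh], [to_shK]). *)

(** * Generators of the 0-Hecke algebra indexed by natural numbers *)

Section Generators.
Variable K : fieldType.

(** Out of range the generator is 1: idempotence, the braid relation and
    commutation then hold for all indices, and no bound has to be carried along. *)
Definition hgen N (j : nat) : hecke K N := oapp hpi 1 (insub j).

Lemma hgenE N (i : 'I_N.-1) : hgen N i = hpi i.
Proof. by rewrite /hgen valK. Qed.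

Lemma hgen_idem N j : hgen N j * hgen N j = hgen N j.
Proof. by rewrite /hgen; case: insubP => [i _ _|_] /=; rewrite ?mul1r ?hpi_idem. Qed.

Lemma hgen_comm N i j : (i.+1 < j)%N -> hgen N i * hgen N j = hgen N j * hgen N i.
Proof.
rewrite /hgen; case: insubP => [i' _ <-|_]; case: insubP => [j' _ <-|_] //= ij;
  rewrite ?mul1r ?mulr1 //; exact: hpi_comm.
Qed.

Lemma hgen_braid N i : hgen N i * (hgen N i.+1 * hgen N i) =
  hgen N i.+1 * (hgen N i * hgen N i.+1).
Proof.
rewrite /hgen; case: insubP => [i' _ Ei|_]; case: insubP => [j' _ Ej|_] /=.
- by apply: hpi_braid; rewrite Ej Ei.
- by rewrite !mul1r ?mulr1 hpi_idem.
- by rewrite !mul1r ?mulr1 hpi_idem.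
- by rewrite !mul1r.
Qed.

Lemma hgen_braidA N i x : hgen N i * (hgen N i.+1 * (hgen N i * x)) =
  hgen N i.+1 * (hgen N i * (hgen N i.+1 * x)).
Proof.
by have /(congr1 (fun y => y * x)) := hgen_braid N i; rewrite -!mulrA.
Qed.

Lemma hecke_ind N (P : hecke K N -> Prop) :
  (forall c, P (scal c)) -> (forall j, (j < N.-1)%N -> P (hgen N j)) ->
  (forall x y, P x -> P y -> P (x + y)) -> (forall x y, P x -> P y -> P (x * y)) ->
  forall x, P x.
Proof.
move=> Ps Pg PD PM; elim/pindP; elim=> [i|c|s IHs t IHt|s IHs t IHt].
- by have := Pg i (ltn_ord i); rewrite hgenE.
- exact: Ps.
- by rewrite pclsD; apply: PD.
- by rewrite pclsM; apply: PM.
Qed.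

Lemma algT_gen_ind (A B : pzAlgType K) (P : algT A B -> Prop) :
  (forall a, P (apure a 1)) -> (forall b, P (apure 1 b)) ->
  (forall x y, P x -> P y -> P (x - y)) -> (forall x y, P x -> P y -> P (x * y)) ->
  forall x, P x.
Proof.
move=> Pl Pr PB PM; elim/(@algT_indP K A B)=> [a b|]; last exact: PB.
by rewrite -[a]mulr1 -[b]mul1r -apureM; apply: PM.
Qed.

Lemma algT_hecke_ind a b (P : algT (hecke K a) (hecke K b) -> Prop) :
  (forall c, P (scal c)) -> (forall j, (j < a.-1)%N -> P (apure (hgen a j) 1)) ->
  (forall j, (j < b.-1)%N -> P (apure 1 (hgen b j))) ->
  (forall x y, P x -> P y -> P (x - y)) -> (forall x y, P x -> P y -> P (x * y)) ->
  forall x, P x.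
Proof.
move=> Ps Pl Pr PB PM.
have PD x y : P x -> P y -> P (x + y).
  move=> Px Py; have P0 := Ps 0; rewrite rmorph0 in P0.
  by rewrite -[y]opprK -[- y]sub0r; apply/PB/PB.
apply: algT_gen_ind => // x; elim/hecke_ind: x => //.
- by move=> x y Px Py; rewrite apureDl; apply: PD.
- by move=> x y Px Py; rewrite -[1]mulr1 -apureM; apply: PM.
- by move=> c; rewrite -[apure 1 _]/(inr_fun (scal c)) inr_scal.
- by move=> x y Px Py; rewrite apureDr; apply: PD.
- by move=> x y Px Py; rewrite -[1]mulr1 -apureM; apply: PM.
Qed.

Lemma apure11 (A B : pzAlgType K) : apure 1 1 = 1 :> algT A B.
Proof. by []. Qed.

Lemma apureS1 (A B : pzAlgType K) c : apure (scal c) 1 = scal c :> algT A B.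
Proof. by []. Qed.

Lemma par_hgenl a b N (eN : (a + b = N)%N) j : (j < a.-1)%N ->
  par K eN (apure (hgen a j) 1) = hgen N j.
Proof.
move=> ja; rewrite -[j]/(nat_of_ord (Ordinal ja)) hgenE par_inl -hgenE /=.
by rewrite add0n.
Qed.

Lemma par_hgenr a b N (eN : (a + b = N)%N) j : (j < b.-1)%N ->
  par K eN (apure 1 (hgen b j)) = hgen N (a + j)%N.
Proof.
move=> ja; rewrite -[j]/(nat_of_ord (Ordinal ja)) hgenE par_inr -hgenE //=.
Qed.

End Generators.

(** * Words with two letters *)

Section Words.
Local Open Scope nat_scope.
Implicit Types (w : nat -> bool) (i j N : nat) (b : bool).

(** A word of length N is a function on [nat] of which only the first N values
    matter: words are then exchanged, cut and shifted without any cast. *)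
Fixpoint letters b w n : nat :=
  if n is n'.+1 then letters b w n' + (w n' == b) else 0.

Definition swap i w : nat -> bool :=
  fun j => if j == i then w i.+1 else if j == i.+1 then w i else w j.

(** The move from a coset representative v to s_i v, when s_i v is a longer
    representative of another coset. *)
Definition raise i w := if ~~ w i && w i.+1 then swap i w else w.

Lemma swap_id i w j : j != i -> j != i.+1 -> swap i w j = w j.
Proof. by rewrite /swap => /negPf-> /negPf->. Qed.
Lemma swap_l i w : swap i w i = w i.+1.
Proof. by rewrite /swap eqxx. Qed.
Lemma swap_r i w : swap i w i.+1 = w i.
Proof. by rewrite /swap eqxx; case: eqP => //; lia. Qed.

Lemma swapK i : involutive (swap i).
Proof.
move=> w; apply: functional_extensionality_dep => j; rewrite {1}/swap swap_l swap_r.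
by case: eqP => [->//|/eqP ji]; case: eqP => [->//|/eqP jSi]; rewrite swap_id.
Qed.

Lemma swap_comm i j w : i.+1 < j -> swap i (swap j w) = swap j (swap i w).
Proof.
move=> ij; apply: functional_extensionality_dep => l; rewrite /swap.
by do ![case: eqP => //=]; try lia; move=> *; congr w; lia.
Qed.

Lemma letters_ext b w w' n : (forall j, j < n -> w j = w' j) ->
  letters b w n = letters b w' n.
Proof.
elim: n => //= n IH ww; rewrite IH ?ww // => j jn; apply: ww; lia.
Qed.

Lemma letters_cat b w n l : letters b w (n + l) =
  letters b w n + letters b (fun j => w (n + j)) l.
Proof. by elim: l => [|l IH] /=; rewrite ?addn0 // addnS /= IH addnA. Qed.

Lemma lettersC w n : letters true w n + letters false w n = n.
Proof. by elim: n => //= n IH; case: (w n) => /=; lia. Qed.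

Lemma letters_le b w i j : i <= j -> letters b w i <= letters b w j.
Proof. by move=> ij; rewrite -(subnKC ij) letters_cat leq_addr. Qed.

Lemma letters_swap_lt b i w n : n <= i -> letters b (swap i w) n = letters b w n.
Proof. by move=> ni; apply: letters_ext => j jn; rewrite swap_id //; apply/eqP;
  lia. Qed.

Lemma letters_swap_r b i w : letters b (swap i w) i.+1 =
  letters b w i + (w i.+1 == b).
Proof. by rewrite /= letters_swap_lt // swap_l. Qed.

Lemma letters_swap_gt b i w n : i.+1 < n -> letters b (swap i w) n = letters b w n.
Proof.
move=> ni; rewrite -(subnKC ni) 2!letters_cat /= letters_swap_lt // swap_l swap_r;
  congr (_ + _).
  lia.
by apply: letters_ext => j _; rewrite swap_id //; apply/eqP; lia.
Qed.

Lemma letters_swap b i w n : n != i.+1 -> letters b (swap i w) n = letters b w n.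
Proof. by case: ltngtP => // ? _;
  [apply: letters_swap_lt|apply: letters_swap_gt]. Qed.

Lemma letters_raise b i w n : n != i.+1 -> letters b (raise i w) n = letters b w n.
Proof. by rewrite /raise; case: ifP => // _; apply: letters_swap. Qed.

(** The sum of the positions of the letters [false]: up to a constant, the length
    of the coset representative, since exchanging a descent lowers it by one. *)
Fixpoint zero_weight w n : nat :=
  if n is n'.+1 then zero_weight w n' + (if w n' then 0 else n') else 0.

Lemma zero_weight_ext w w' n : (forall j, j < n -> w j = w' j) ->
  zero_weight w n = zero_weight w' n.
Proof.
elim: n => //= n IH ww; rewrite IH ?ww // => j jn; apply: ww; lia.
Qed.

Lemma zero_weight_swap i w n : i.+1 < n -> w i -> ~~ w i.+1 ->
  zero_weight w n = (zero_weight (swap i w) n).+1.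
Proof.
move=> + wi wSi; elim: n => // n IH; rewrite ltnS leq_eqVlt => /predU1P[<-|lt] /=.
  rewrite swap_l swap_r wi (negPf wSi) (@zero_weight_ext (swap i w) w) ?addn0;
    first lia.
  by move=> j ji; rewrite swap_id //; apply/eqP; lia.
by rewrite IH // swap_id // gtn_eqF //; lia.
Qed.

Lemma sorted_false N w : (forall l, l.+1 < N -> w l -> w l.+1) ->
  forall i, i < N -> ~~ w i -> letters false w i = i.
Proof.
move=> st; elim=> //= i IH iN wi.
have wi' : ~~ w i by apply: contra wi; apply: st.
by rewrite IH // ?(negPf wi') ?addn1 //; lia.
Qed.

Lemma sorted_true N w : (forall l, l.+1 < N -> w l -> w l.+1) ->
  forall i, i < N -> w i -> letters false w N = letters false w i.
Proof.
move=> st i iN wi.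
have wt d : i + d < N -> w (i + d).
  elim: d => [|d IH]; first by rewrite addn0.
  by rewrite addnS => lt; apply: st => //; apply: IH; lia.
have : N = i + (N - i) by lia.
move: (N - i) (wt) => d + e; rewrite e => {}wt.
rewrite letters_cat; elim: d wt {e} => [|d IH] wt /=; first by rewrite addn0.
rewrite wt ?addn0; last by rewrite ltn_add2l.
by apply: IH => l ll; apply: wt; lia.
Qed.

Definition sorted_word (n j : nat) : bool := (n <= j).

Lemma letters_sorted_word c n j : (c || (j <= n)) ->
  letters c (sorted_word n) (if c then n + j else j) = j.
Proof.
have E i : (i <= n) -> letters c (sorted_word n) i = if c then 0 else i.
  elim: i => [|i IH] le /=; first by case: (c).
  by rewrite IH ?(ltnW le) // /sorted_word leqNgt le; case: (c);
    rewrite /= ?addn0 ?addn1.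
case: c E => [] E jn; last by rewrite E.
rewrite letters_cat E // add0n; elim: j {jn} => //= j ->;
  rewrite /sorted_word leq_addr /=; lia.
Qed.

Lemma descP n w : (exists l, [/\ (l.+1 < n), w l & ~~ w l.+1]) \/
  (forall l, (l.+1 < n) -> w l -> w l.+1).
Proof.
have [[l h]|h] := pselect (exists l, [/\ (l.+1 < n), w l & ~~ w l.+1]).
  by left; exists l.
by right=> l ln wl; apply/negPn/negP => wSl; apply: h; exists l.
Qed.

End Words.

(** * Minimal coset representatives in the 0-Hecke algebra *)

Section CosetElements.
Variable (K : fieldType).
Implicit Types (w : nat -> bool) (i j N : nat) (b : bool).

(** Sorts the word by exchanging descents, recording the generators; [n] is
    the fuel of the recursion. *)
Fixpoint coset_elt_rec N n w : hecke K N :=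
  if n is n'.+1 then
    if [pick i : 'I_N.-1 | w i && ~~ w i.+1] is Some i then hgen K N i *
      coset_elt_rec N n' (swap i w)
    else 1
  else 1.

(** Each exchange lowers the weight by exactly one, so the weight is enough fuel. *)
Definition coset_elt N w := coset_elt_rec N (zero_weight w N) w.

Lemma swap_ext N i w w' : (i.+1 < N)%N -> (forall j, (j < N)%N -> w j = w' j) ->
  forall j, (j < N)%N -> swap i w j = swap i w' j.
Proof. by move=> iN ww j jN; rewrite /swap !ww //; lia. Qed.

Lemma coset_elt_ext N w w' : (forall j, (j < N)%N -> w j = w' j) ->
  coset_elt N w = coset_elt N w'.
Proof.
move=> ww; rewrite /coset_elt (zero_weight_ext ww); move: (zero_weight w' N) => n.
elim: n w w' ww => //= n IH w w' ww.
rewrite (eq_pick (Q := fun i : 'I_N.-1 => w' i && ~~ w' i.+1)); last first.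
  by move=> [i /= iN]; rewrite !ww //; lia.
case: pickP => // i _; congr (_ * _); apply: IH; apply: swap_ext ww.
by case: i => i /=; lia.
Qed.

Lemma coset_elt_sorted N w : (forall l, (l.+1 < N)%N -> w l -> w l.+1) ->
  coset_elt N w = 1.
Proof.
move=> st; rewrite /coset_elt; case: zero_weight => //= n;
  case: pickP => // -[i /= iN].
by case/andP => wi; rewrite st //; lia.
Qed.

(** The choice of the descent does not matter: two descents of a word with
    two letters are never adjacent, so that their generators commute. *)
Lemma coset_elt_desc N w i : (i.+1 < N)%N -> w i -> ~~ w i.+1 ->
  coset_elt N w = hgen K N i * coset_elt N (swap i w).
Proof.
move En: (zero_weight w N) => n; elim/ltn_ind: n w i En => n IH w i En iN wi wSi.
have Tl : exists l, [/\ (l.+1 < N)%N, w l, ~~ w l.+1 & coset_elt N w =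
  hgen K N l * coset_elt N (swap l w)].
  have E := zero_weight_swap iN wi wSi.
  rewrite /coset_elt E /=; case: pickP => [[l /= lN] /andP[wl wSl]|]; last first.
    move=> nd; have iN' : (i < N.-1)%N by lia.
    by have := nd (Ordinal iN'); rewrite /= wi wSi.
  exists l; have lN' : (l.+1 < N)%N by lia.
  by split=> //; have := zero_weight_swap lN' wl wSl; rewrite E => -[->].
have [l [lN wl wSl ->]] := Tl.
case: (eqVneq l i) => [->//|li].
have [l1 l2] : l != i.+1 /\ l.+1 != i
  by split; apply/eqP => E; subst; rewrite ?wl ?wi in wSi wSl *.
have El := zero_weight_swap lN wl wSl; have Ei := zero_weight_swap iN wi wSi.
have wl' : swap i w l /\ ~~ swap i w l.+1 by rewrite !swap_id //; apply/eqP; lia.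
have wi' : swap l w i /\ ~~ swap l w i.+1 by rewrite !swap_id //; apply/eqP; lia.
rewrite (IH (zero_weight (swap l w) N) _ (swap l w) i) //; try tauto;
  last by rewrite -En El.
rewrite (IH (zero_weight (swap i w) N) _ (swap i w) l) //; try tauto;
  last by rewrite -En Ei.
rewrite !mulrA.
have : (i.+1 < l \/ l.+1 < i)%N by lia.
by case=> h; rewrite (hgen_comm _ _ h) (swap_comm _ h).
Qed.

(** If s_i does not move the coset of v then s_i v = v s_j, where s_j exchanges two
    neighbours of one block, and the number of letters of this block before i
    tells which ones. The induction pulls out a descent; when it touches i the
    braid relation applies. *)
Lemma coset_elt_same N a w i : (i.+1 < N)%N -> w i = w i.+1 ->
  letters false w N = a ->
  hgen K N i * coset_elt N w =
  coset_elt N w * hgen K N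
    (if w i then (a + letters true w i)%N else letters false w i).
Proof.
move En: (zero_weight w N) => n; elim/ltn_ind: n w i En => n IH w i En iN wi wa.
case: (pickP (fun l : 'I_N.-1 => w l && ~~ w l.+1)) => [[l /= lN']|nd]; last first.
  have st l : (l.+1 < N)%N -> w l -> w l.+1.
    move=> lN wl; have lN' : (l < N.-1)%N by lia.
    by have := nd (Ordinal lN'); rewrite /= wl => /negbFE.
  rewrite coset_elt_sorted // mulr1 mul1r; congr (hgen K N _).
  case: ifPn => w_i; last by rewrite (sorted_false st) //; lia.
  by rewrite -wa (sorted_true st (ltnW iN) w_i) addnC lettersC.
case/andP => wl wSl; have lN : (l.+1 < N)%N by lia.
have El := zero_weight_swap lN wl wSl.
case: (eqVneq l i) => [E|li]; first by move: wSl; rewrite E -wi -E wl.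
have cN u m : (m.+1 < N)%N -> letters false (swap m u) N = letters false u N.
  by move=> mN; apply: letters_swap; rewrite gtn_eqF.
rewrite (coset_elt_desc lN wl wSl).
case: (eqVneq l i.+1) => [E|l1].
- (* Letters 1 1 0, with 1 for [true]: pulling out two generators gives the
     word 0 1 1, where the equal letters sit one place further. *)
  subst l.
  have d1 : swap i.+1 w i = true by rewrite swap_id ?wi //; apply/eqP; lia.
  have d2 : swap i.+1 w i.+1 = false by rewrite swap_l (negPf wSl).
  have d3 : swap i.+1 w i.+2 = true by rewrite swap_r.
  rewrite (@coset_elt_desc N (swap i.+1 w) i) ?d1 ?d2 //.
  have e1 : swap i (swap i.+1 w) i.+1 = true by rewrite swap_r d1.
  have e2 : swap i (swap i.+1 w) i.+2 = true by rewrite swap_id ?d3 //;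
    apply/eqP; lia.
  rewrite hgen_braidA -!mulrA; congr (_ * (_ * _)).
  rewrite (IH _ _ (swap i (swap i.+1 w)) i.+1 (erefl _)) ?e1 ?e2 ?cN //; last first.
    have := zero_weight_swap (w := swap i.+1 w) iN; rewrite d1 d2 -En El => ->//; lia.
  by rewrite letters_swap_r d2 addn0 letters_swap_lt // wi wl.
case: (eqVneq l.+1 i) => [E|l2].
- (* Letters 1 0 0: mirror case, reaching 0 0 1. *)
  subst i; move/negPf in wSl; move: (wi); rewrite wSl => /esym wSSl.
  have d1 : swap l w l = false by rewrite swap_l.
  have d2 : swap l w l.+1 = true by rewrite swap_r wl.
  have d3 : swap l w l.+2 = false by rewrite swap_id ?wSSl //; apply/eqP; lia.
  rewrite (@coset_elt_desc N (swap l w) l.+1) ?d2 ?d3 //.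
  have e1 : swap l.+1 (swap l w) l = false by rewrite swap_id ?d1 //; apply/eqP; lia.
  have e2 : swap l.+1 (swap l w) l.+1 = false by rewrite swap_l d3.
  rewrite -hgen_braidA -!mulrA; congr (_ * (_ * _)).
  rewrite (IH _ _ (swap l.+1 (swap l w)) l (erefl _)) ?e1 ?e2 ?cN //; last first.
    have := zero_weight_swap (w := swap l w) iN; rewrite d2 d3 -En El => ->//; lia.
  by rewrite !letters_swap_lt //= wl addn0.
have -> : hgen K N i * (hgen K N l * coset_elt N (swap l w)) =
  hgen K N l * (hgen K N i * coset_elt N (swap l w)).
  rewrite !mulrA; congr (_ * _).
  have : (i.+1 < l \/ l.+1 < i)%N by lia.
  by case=> h; rewrite (hgen_comm _ _ h).
have f1 : swap l w i = w i by rewrite swap_id // eq_sym.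
have f2 : swap l w i.+1 = w i.+1 by rewrite swap_id //; apply/eqP; lia.
rewrite (IH _ _ (swap l w) i (erefl _)) ?f1 ?f2 ?cN //; last by rewrite -En El.
by rewrite mulrA !letters_swap // eq_sym.
Qed.

Lemma coset_elt_sorted_word N a : coset_elt N (sorted_word a) = 1.
Proof. by apply: coset_elt_sorted => l _; rewrite /sorted_word; lia. Qed.

Section Parabolic.
Variables (a b N : nat) (eN : (a + b = N)%N).
Local Notation par := (par K eN).
Local Notation AB := (algT (hecke K a) (hecke K b)).

Definition fgen (c : bool) j : AB :=
  if c then apure 1 (hgen K b j) else apure (hgen K a j) 1.

(** What is left on the right of the representative after multiplication on the
    left by the i-th generator; see [hgen_coset_elt]. *)
Definition residue i w : AB :=
  if w i == w i.+1 then fgen (w i) (letters (w i) w i) else 1.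

Arguments fgen : simpl never.

Lemma par_fgen c j : (j < (if c then b else a).-1)%N ->
  par (fgen c j) = hgen K N (if c then (a + j)%N else j).
Proof. by case: c => ?; [apply: par_hgenr|apply: par_hgenl]. Qed.

Lemma letters_residue w i : (i.+1 < N)%N -> w i = w i.+1 -> letters false w N = a ->
  (letters (w i) w i < (if w i then b else a).-1)%N.
Proof.
move=> iN wi wa.
have le c : (letters c w i.+2 <= letters c w N)%N by apply: letters_le.
have := lettersC w N; move: (le true) (le false); rewrite /= -wi.
by case: (w i) => /=; lia.
Qed.

(** The multiplication rule that governs the whole proof: in all cases a
    generator times a representative is a representative times an element of the
    parabolic subalgebra. *)
Lemma hgen_coset_elt w i : (i.+1 < N)%N -> letters false w N = a ->
  hgen K N i * coset_elt N w = coset_elt N (raise i w) * par (residue i w).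
Proof.
move=> iN wa; rewrite /residue; case: eqP => [wi|/eqP wi].
  rewrite par_fgen ?letters_residue // (coset_elt_same _ wi wa) // /raise -wi andNb.
  by case: (w i).
rewrite rmorph1 mulr1 /raise; case: ifP => c.
  case/andP: c => sorted_word w1.
  rewrite (@coset_elt_desc N (swap i w) i iN) ?swapK // ?swap_l ?swap_r //.
have [w1 sorted_word] : w i /\ ~~ w i.+1 by case: (w i) (w i.+1) c wi => [] [].
by rewrite (coset_elt_desc iN) // mulrA hgen_idem.
Qed.

Lemma fgen_idem c j : fgen c j * fgen c j = fgen c j.
Proof. by rewrite /fgen; case: c; rewrite apureM hgen_idem mul1r. Qed.

Lemma fgen_braid c j :
  fgen c j * (fgen c j.+1 * fgen c j) = fgen c j.+1 * (fgen c j * fgen c j.+1).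
Proof. by rewrite /fgen; case: c; rewrite !apureM hgen_braid !mul1r. Qed.

Lemma fgen_comm c i j : (i.+1 < j)%N -> fgen c i * fgen c j = fgen c j * fgen c i.
Proof. by move=> ij; rewrite /fgen; case: c; rewrite !apureM (hgen_comm _ _ ij). Qed.

Lemma fgen_commC c i j : fgen c i * fgen (~~ c) j = fgen (~~ c) j * fgen c i.
Proof. by rewrite /fgen; case: c; rewrite !apureM !(mul1r, mulr1). Qed.

End Parabolic.
End CosetElements.

Arguments fgen : simpl never.

(** * The shuffle module *)

Section ShuffleModule.
Variables (K : fieldType) (a b N : nat).
Local Notation AB := (algT (hecke K a) (hecke K b)).
Local Notation residue := (@residue K a b).
Local Notation fgen := (@fgen K a b).
Variable X : lmodType AB.
Implicit Types (w : nat -> bool) (x : X) (i j : nat).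

(** The rule [hgen_coset_elt], read as an action on pairs (representative, vector). *)
Definition step i (p : (nat -> bool) * X) := (raise i p.1, residue i p.1 *: p.2).

Lemma step_eq i w x c : w i = c -> w i.+1 = c ->
  step i (w, x) = (w, fgen c (letters c w i) *: x).
Proof. by rewrite /step /= /residue /raise => -> ->; rewrite eqxx andNb. Qed.

Lemma step01 i w x : w i = false -> w i.+1 = true -> step i (w, x) = (swap i w, x).
Proof. by rewrite /step /= /residue /raise => -> ->; rewrite scale1r. Qed.

Lemma step10 i w x : w i = true -> w i.+1 = false -> step i (w, x) = (w, x).
Proof. by rewrite /step /= /residue /raise => -> ->; rewrite scale1r. Qed.

Lemma step_idem i p : step i (step i p) = step i p.
Proof.
case: p => w x; case E0: (w i); case E1: (w i.+1).
- by rewrite !(step_eq _ E0 E1) scalerA fgen_idem.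
- by rewrite !(step10 _ E0 E1).
- by rewrite (step01 _ E0 E1) step10 ?swap_l ?swap_r.
- by rewrite !(step_eq _ E0 E1) scalerA fgen_idem.
Qed.

Lemma raise_id i j w : j != i -> j != i.+1 -> raise i w j = w j.
Proof. by rewrite /raise => ji jSi; case: ifP => // _; rewrite swap_id. Qed.

Lemma residue_raise i j w : j != i -> j != i.+1 -> j.+1 != i ->
  residue j (raise i w) = residue j w.
Proof. by move=> ? ? ?; rewrite /residue !raise_id // letters_raise. Qed.

Lemma raise_comm i j w : (i.+1 < j)%N -> raise i (raise j w) = raise j (raise i w).
Proof.
move=> ij; rewrite {1 3}/raise !raise_id; try by apply/eqP; lia.
rewrite /raise; do ![case: ifP => //] => _ _; exact: swap_comm.
Qed.

Lemma residue_comm i j w : (i.+1 < j)%N ->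
  residue i w * residue j w = residue j w * residue i w.
Proof.
move=> ij; rewrite /residue; case: eqP => [ei|_]; last by rewrite mul1r mulr1.
case: eqP => [ej|_]; last by rewrite mul1r mulr1.
case: (eqVneq (w i) (w j)) => [<-|].
  apply: fgen_comm; have := @letters_le (w i) w i.+2 j ij.
  by rewrite /= -ei eqxx; lia.
by case: (w i) (w j) => [] [] // _;
  rewrite (fgen_commC _ _ _ true, fgen_commC _ _ _ false).
Qed.

Lemma step_comm i j p : (i.+1 < j)%N -> step i (step j p) = step j (step i p).
Proof.
case: p => w x ij; rewrite /step /= raise_comm //; congr (_, _).
by rewrite !residue_raise ?scalerA ?(residue_comm _ ij) //; apply/eqP; lia.
Qed.

Lemma swap_below i w : swap i.+1 w i = w i.
Proof. by rewrite swap_id //; apply/eqP; lia. Qed.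
Lemma swap_above i w : swap i w i.+2 = w i.+2.
Proof. by rewrite swap_id //; apply/eqP; lia. Qed.
Let swE := (swap_l, swap_r, swap_below, swap_above).

(** One case for each value of the letters at i, i + 1 and i + 2; the braid
    relation of the parabolic subalgebra enters when the three are equal. *)
Lemma step_braid i p :
  step i (step i.+1 (step i p)) = step i.+1 (step i (step i.+1 p)).
Proof.
case: p => w x; case E0: (w i); case E1: (w i.+1); case E2: (w i.+2).
- rewrite !(step_eq _ E0 E1, step_eq _ E1 E2) /= E0 eqxx addn1.
  by rewrite !scalerA -!mulrA fgen_braid.
- by rewrite !(step_eq _ E0 E1, step10 _ E1 E2) scalerA fgen_idem.
- rewrite (step10 _ E0 E1) (step01 _ E1 E2) !(@step_eq i _ _ true) ?swE //.
  by rewrite step10 ?swE.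
- rewrite (step10 _ E0 E1) !(step_eq _ E1 E2) (step10 _ E0 E1) (step_eq _ E1 E2).
  by rewrite scalerA fgen_idem.
- rewrite (step01 _ E0 E1) (step_eq _ E1 E2) (step01 _ E0 E1).
  rewrite !(@step01 i.+1 (swap i w)) ?swE // (@step_eq i _ _ true) ?swE //.
  by rewrite !letters_swap_lt ?leqnSn //= E0 addn0.
- rewrite (step01 _ E0 E1) (step10 _ E1 E2) (step01 _ E0 E1).
  by rewrite (@step_eq i.+1 _ _ false) ?swE // step10 ?swE.
- rewrite (step_eq _ E0 E1) !(step01 _ E1 E2) step01 ?swE //.
  rewrite (@step01 i (swap i.+1 w)) ?swE // (@step_eq i.+1 _ _ false) ?swE //.
  by rewrite letters_swap_r swap_l E2 addn0 letters_swap_lt ?leqnSn.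
- rewrite !(step_eq _ E0 E1, step_eq _ E1 E2) /= E0 eqxx addn1.
  by rewrite !scalerA -!mulrA fgen_braid.
Qed.

Lemma step_ext i w w' x : (i.+1 < N)%N -> (forall j, (j < N)%N -> w j = w' j) ->
  (forall j, (j < N)%N -> (step i (w, x)).1 j = (step i (w', x)).1 j) /\
  (step i (w, x)).2 = (step i (w', x)).2.
Proof.
move=> iN ww; split=> [j jN|] /=.
  rewrite /raise !ww //; try lia.
  by case: ifP => _; [apply: swap_ext ww _ _|apply: ww].
rewrite /residue !ww //; try lia.
by rewrite (letters_ext _ (w' := w')) // => j ji; apply: ww; lia.
Qed.

(** [X] is a vector space over K by restriction along [scal]. *)
Definition vspace := {ffun N.-tuple bool -> res (scal : {rmorphism K -> AB}) X}.

Definition word (u : N.-tuple bool) (j : nat) : bool := nth false u j.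
Definition wtuple w : N.-tuple bool := [tuple w i | i < N].

Lemma wtupleK w j : (j < N)%N -> word (wtuple w) j = w j.
Proof. by move=> jN; rewrite /word (nth_mktuple _ _ (Ordinal jN)). Qed.

Lemma wordK u : wtuple (word u) = u.
Proof. by apply: eq_from_tnth => i; rewrite tnth_mktuple /word -tnth_nth. Qed.

Lemma wtuple_ext w w' : (forall j, (j < N)%N -> w j = w' j) -> wtuple w = wtuple w'.
Proof. by move=> ww; apply: eq_from_tnth => i; rewrite !tnth_mktuple ww. Qed.

Definition delta (p : (nat -> bool) * X) : vspace :=
  [ffun u => if u == wtuple p.1 then p.2 else 0].

Definition op_fun (i : 'I_N.-1) (v : vspace) : vspace :=
  \sum_u delta (step i (word u, v u)).

Lemma delta_ext w w' x : (forall j, (j < N)%N -> w j = w' j) ->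
  delta (w, x) = delta (w', x).
Proof. by move=> ww; rewrite /delta /= (wtuple_ext ww). Qed.

Lemma delta_linear w : linear (fun x : res (scal : {rmorphism K ->
  AB}) X => delta (w, x)).
Proof.
move=> c x y; apply/ffunP => u; rewrite !ffunE /=.
by case: eqP => // _; rewrite scaler0 addr0.
Qed.

Lemma op_linear (i : 'I_N.-1) : linear (op_fun i).
Proof.
move=> c u v; rewrite /op_fun scaler_sumr -big_split /=; apply: eq_bigr => g _.
rewrite -delta_linear; congr (delta (_, _)); rewrite /= !ffunE scalerDr;
  congr (_ + _).
by rewrite scal_scaleC.
Qed.

HB.instance Definition _ (i : 'I_N.-1) :=
  GRing.isLinear.Build K vspace vspace _ (op_fun i)
  (op_linear i).

Definition op (i : 'I_N.-1) : {linear vspace -> vspace} := op_fun i.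

Lemma delta_sum (v : vspace) : v = \sum_u delta (word u, v u).
Proof.
apply/ffunP => h; rewrite sum_ffunE (bigD1 h) //= big1 ?addr0 => [|g /negPf gh].
  by rewrite !ffunE /= wordK eqxx.
by rewrite !ffunE /= wordK eq_sym gh.
Qed.

Lemma op_delta (i : 'I_N.-1) p : op i (delta p) = delta (step i p).
Proof.
case: p => w x; rewrite /= /op_fun (bigD1 (wtuple w)) //= big1 ?addr0 => [|u
  /negPf uw].
  rewrite ffunE eqxx /=.
  have iN : (i.+1 < N)%N by case: i => i /=; lia.
  have [e1 e2] := @step_ext i (word (wtuple w)) w x iN (@wtupleK w).
  by rewrite (surjective_pairing (step _ _)) (delta_ext _ e1) e2.
rewrite ffunE /= uw; apply/ffunP => u'; rewrite !ffunE /=; case: ifP => // _.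
exact: (@scaler0 AB X (residue i (word u))).
Qed.

Lemma op_rel s t : @hecke_rel K N s t -> oact op s =1 oact op t.
Proof.
move=> st v; rewrite (delta_sum v).
have z r : oact op r 0 = 0 by have := oactZ op r 0 0; rewrite !scale0r.
rewrite !(big_morph _ (oactD op _) (z _)); apply: eq_bigr => u _.
apply: (@hecke_rel_oact K N _ _ op delta xpredT step) st _ _ => //.
- by move=> i p _; exact: op_delta.
- by move=> i p; exact: step_idem.
- by move=> i j p ->; exact: step_braid.
- by move=> i j p; exact: step_comm.
Qed.

(** The words with [a] letters [false] form a copy of the induced module, whose
    underlying space is known in advance.
    That the rule of [step] defines an action on it amounts to the freeness of
    the algebra over its parabolic subalgebra, with the elements [coset_elt] as
    a basis. *)
Definition shmod : Type := vspace.
HB.instance Definition _ := GRing.Zmodule.on shmod.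

Definition shscale (h : hecke K N) (v : shmod) : shmod := pact op h v.

Lemma shscaleA (x y : hecke K N) v : shscale x (shscale y v) = shscale (x * y) v.
Proof. exact: (pactA op_rel). Qed.
Lemma shscale1 : left_id 1 shscale.
Proof. exact: (pact1 op_rel). Qed.
Lemma shscaleDr : right_distributive shscale +%R.
Proof. exact: pactDr. Qed.
Lemma shscaleDl (v : shmod) : {morph shscale^~ v : h h' / h + h'}.
Proof. exact: (pactDl op_rel). Qed.

HB.instance Definition _ := GRing.Zmodule_isLmodule.Build (hecke K N) shmod
  shscaleA shscale1 shscaleDr shscaleDl.

Definition shvec w (x : X) : shmod := delta (w, x).

Lemma shvec_ext w w' x : (forall j, (j < N)%N -> w j = w' j) ->
  shvec w x = shvec w' x.
Proof. exact: delta_ext. Qed.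

Lemma shvecB w : {morph shvec w : x y / x - y}.
Proof.
by move=> x y; apply/ffunP => u; rewrite !ffunE /=; case: ifP; rewrite ?subr0.
Qed.

Lemma shvec_sum (v : shmod) : v = \sum_u shvec (word u) (v u).
Proof. exact: delta_sum. Qed.

Lemma hgen_shvec i w x : (i.+1 < N)%N ->
  hgen K N i *: shvec w x = shvec (raise i w) (residue i w *: x).
Proof.
move=> iN; have iN' : (i < N.-1)%N by lia.
rewrite (hgenE K (Ordinal iN')) [LHS](pact_cls op_rel) /=.
exact: (@op_delta (Ordinal iN') (w, x)).
Qed.

Lemma scal_shvec c w x : scal c *: shvec w x = shvec w ((scal c : AB) *: x).
Proof.
rewrite [LHS](pact_cls op_rel (AScal _ c)) /=.
apply/ffunP => u; rewrite !ffunE /=; by case: ifP => // _; rewrite scaler0.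
Qed.

End ShuffleModule.

(** * Sums of modules and induced modules *)

Section SubtractionMorphisms.
Context {U V : zmodType} {f : U -> V} (fB : {morph f : x y / x - y}).

Lemma morphB0 : f 0 = 0.
Proof. by rewrite -(subrr 0) fB subrr. Qed.

Lemma morphBD : {morph f : x y / x + y}.
Proof. by move=> x y; apply: (addIr (- f y)); rewrite -fB !addrK. Qed.

Lemma morphB_sum (I : Type) (r : seq I) (P : pred I) (F : I -> U) :
  f (\sum_(i <- r | P i) F i) = \sum_(i <- r | P i) f (F i).
Proof. exact: (big_morph f morphBD morphB0). Qed.

End SubtractionMorphisms.

Section DirectSumDecomposition.
Variables (A : pzRingType) (I : finType) (Y : lmodType A) (D : I -> lmodType A).
Variables (f : forall p, Y -> D p) (g : forall p, D p -> Y).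
Arguments g : clear implicits.
Hypotheses (fB : forall p, {morph f p : x y / x - y})
           (fZ : forall p a y, f p (a *: y) = a *: f p y)
           (gB : forall p, {morph g p : x y / x - y})
           (gK : forall p, cancel (g p) (f p))
           (fg0 : forall p q y, q != p -> f q (g p y) = 0).
Hypothesis span : forall Q : Y -> Prop,
  (forall p y, g p (f p y) = y -> (forall q, q != p -> f q y = 0) -> Q y) ->
  (forall y z, Q y -> Q z -> Q (y + z)) -> Q 0 -> forall y, Q y.

Let F (y : Y) : dsum D := fun p => f p y.
Let G (u : dsum D) : Y := \sum_p g p (u p).

Let F_linear : linear F.
Proof.
move=> a y z; apply: functional_extensionality_dep => p.
by rewrite /F (morphBD (@fB p)) fZ.
Qed.

Let GK : cancel G F.
Proof.
move=> u; apply: functional_extensionality_dep => q.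
rewrite /F /G (morphB_sum (@fB q)) (bigD1 q) //= gK big1 ?addr0 // => p pq.
by rewrite fg0 // eq_sym.
Qed.

Let FK : cancel F G.
Proof.
apply: span => [p y gfy f0|y z Fy Fz|].
- rewrite /G (bigD1 p) //= gfy big1 ?addr0 // => q qp.
  by rewrite /F f0 // (morphB0 (@gB q)).
- rewrite -{2}Fy -{2}Fz /G -big_split; apply: eq_bigr => p _.
  by rewrite /F (morphBD (@fB p)) (morphBD (@gB p)).
- by rewrite /G big1 // => p _; rewrite /F (morphB0 (@fB p)) (morphB0 (@gB p)).
Qed.

(** The maps [g p] embed the summands and the [f p] project onto them. That they
    exhaust [Y] only has to be seen on vectors that lie in one summand, provided
    such vectors span [Y]. *)
Lemma dsum_decomposition : exists h : {linear Y -> dsum D}, bijective h.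
Proof.
pose m := GRing.isLinear.Build A Y (dsum D) *:%R F F_linear.
by exists (HB.pack F m : {linear Y -> dsum D}); exists G; [exact: FK|exact: GK].
Qed.

End DirectSumDecomposition.

Section InducedTensors.
Context {A B : pzRingType} (phi : {rmorphism B -> A}) (M : lmodType B).

Lemma ipureZ h b (x : M) : ipure phi h (b *: x) = ipure phi (h * phi b) x.
Proof. by rewrite [RHS](tpureS b). Qed.

Lemma ipureB h : {morph (fun x : M => ipure phi h x) : x y / x - y}.
Proof.
move=> x y /=; apply: (addIr (ipure phi h y)).
by rewrite subrK -[LHS]tpureDr subrK.
Qed.

Lemma ind_scalerB a : {morph (fun x : ind phi M => a *: x) : x y / x - y}.
Proof. exact: iscaleB. Qed.

End InducedTensors.

(** Frobenius reciprocity, in the direction that yields maps out of an induced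
    module. *)
Section IndLift.
Context {A B : pzRingType} (phi : {rmorphism B ->
  A}) (M : lmodType B) (Y : lmodType A).
Variable (f : M -> Y).

Definition ind_lift_fun (a : A) (x : M) : Y := a *: f x.

Hypotheses (fB : {morph f : x y / x - y}) (fS : forall b x, f (b *: x) =
  phi b *: f x).

Lemma ind_lift_bal : balanced (fun (b : B) (a : A) => a * phi b)
  (fun (b : B) (m : M) => b *: m) ind_lift_fun.
Proof.
rewrite /ind_lift_fun; split=> [a a' x|a x y|b a x].
- exact: scalerDl.
- by rewrite (morphBD fB) scalerDr.
- by rewrite fS scalerA.
Qed.

Definition ind_lift : {additive ind phi M -> Y} := tlift ind_lift_bal.

Lemma ind_liftE a x : ind_lift (ipure phi a x) = a *: f x.
Proof. exact: tliftE. Qed.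

Lemma ind_liftB : {morph ind_lift : x y / x - y}.
Proof. exact: raddfB. Qed.

Lemma ind_liftZ a (y : ind phi M) : ind_lift (a *: y) = a *: ind_lift y.
Proof.
elim/(@ind_indP A B phi M): y => [b x|x y IHx IHy].
  by rewrite ind_scaleE !ind_liftE scalerA.
by rewrite !raddfB /= IHx IHy.
Qed.

End IndLift.

(** The tensor products over K of modules and of their restrictions have the same
    pure tensors but are quotients by differently presented relations, so the
    identification has to be built in both directions. *)
Section RestrictTensor.
Context {K : fieldType} {A B A' B' : pzAlgType K} (f : algHom A' A) (g : algHom B' B)
  (M : lmodType A) (L : lmodType B).

Lemma restens_bal : balanced (fun (c : K) (m : M) => (scal c : A) *: m)
  (fun (c : K) (n : L) => (scal c : B) *: n)
  (fun x y => tpure (x : res f M) (y : res g L) : modT (res f M) (res g L)).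
Proof.
split=> [x x' y|x y y'|c x y].
- exact: tpureDl.
- exact: tpureDr.
- have := @tpureS _ _ _ (fun (c : K) (m : res f M) => (scal c : A') *: m)
    (fun (c : K) (n : res g L) => (scal c : B') *: n) c x y.
  rewrite -[(scal c : A') *: (x : res f M)]/(f (scal c) *: (x : M)).
  rewrite -[(scal c : B') *: (y : res g L)]/(g (scal c) *: (y : L)).
  by rewrite !scal_morphism.
Qed.

Definition restens : {additive modT M L -> modT (res f M) (res g L)} :=
  tlift restens_bal.

Lemma restensE x y : restens (tpure x y) = tpure (x : res f M) (y : res g L).
Proof. exact: tliftE. Qed.

Lemma unrestens_bal : balanced (fun (c : K) (m : res f M) => (scal c : A') *: m)
  (fun (c : K) (n : res g L) => (scal c : B') *: n)
  (fun x y => tpure (x : M) (y : L) : modT M L).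
Proof.
split=> [x x' y|x y y'|c x y].
- exact: tpureDl.
- exact: tpureDr.
- rewrite -[(scal c : A') *: (x : res f M)]/(f (scal c) *: (x : M)).
  rewrite -[(scal c : B') *: (y : res g L)]/(g (scal c) *: (y : L)).
  by rewrite !scal_morphism; exact: (tpureS c).
Qed.

Definition unrestens : {additive modT (res f M) (res g L) -> modT M L} :=
  tlift unrestens_bal.

Lemma unrestensE x y : unrestens (tpure x y) = tpure (x : M) (y : L).
Proof. exact: tliftE. Qed.

Lemma restensK : cancel restens unrestens.
Proof.
elim/tensor_indP=> [x y|x y IHx IHy]; first by rewrite restensE unrestensE.
by rewrite !raddfB IHx IHy.
Qed.

Lemma unrestensK : cancel unrestens restens.
Proof.
elim/tensor_indP=> [x y|x y IHx IHy]; first by rewrite unrestensE restensE.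
by rewrite !raddfB IHx IHy.
Qed.

Lemma restensB : {morph restens : x y / x - y}.
Proof. exact: raddfB. Qed.

Lemma unrestensB : {morph unrestens : x y / x - y}.
Proof. exact: raddfB. Qed.

Lemma restensZ a b x : restens (apure (f a) (g b) *: x) = apure a b *: restens x.
Proof.
elim/tensor_indP: x => [x y|x y IHx IHy].
  by rewrite modT_scaleE !restensE modT_scaleE.
by rewrite !raddfB /= IHx IHy.
Qed.

End RestrictTensor.

(** * The induced module is the shuffle module *)

Section InductionModel.
Variables (K : fieldType) (a b N : nat) (eN : (a + b = N)%N).
Local Notation AB := (algT (hecke K a) (hecke K b)).
Local Notation residue := (@residue K a b).
Local Notation par := (par K eN).
Variable X : lmodType AB.
Implicit Types (w : nat -> bool) (x : X).
Local Notation Sh := (shmod N X).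
Local Notation Ind := (ind par X).

(** Maps out of the shuffle module, given word by word. *)
Section ShSum.
Variables (Z : zmodType) (g : (nat -> bool) -> X -> Z).
Hypothesis gB : forall w, {morph g w : x y / x - y}.
Hypothesis gE : forall w w' x, (forall j, (j < N)%N -> w j = w' j) -> g w x = g w' x.

Definition shsum (v : Sh) : Z := \sum_u g (word u) (v u).

Lemma shsumB : {morph shsum : v v' / v - v'}.
Proof.
move=> v v'; rewrite /shsum -sumrB; apply: eq_bigr => u _.
by rewrite -gB; congr g; rewrite !ffunE.
Qed.

Lemma shsum_vec w x : shsum (shvec N w x) = g w x.
Proof.
rewrite /shsum (bigD1 (wtuple N w)) //= big1 ?addr0 => [|u /negPf uw].
  by rewrite ffunE eqxx /=; apply: gE; exact: wtupleK.
by rewrite ffunE /= uw (morphB0 (gB _)).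
Qed.

Lemma shsum_hgen i (phi : Z -> Z) : (i.+1 < N)%N -> {morph phi : x y / x - y} ->
  (forall w x, g (raise i w) (residue i w *: x) = phi (g w x)) ->
  forall v, shsum (hgen K N i *: v) = phi (shsum v).
Proof.
move=> iN phiB gp v; rewrite {1}(shvec_sum v) scaler_sumr.
rewrite (morphB_sum shsumB) [in RHS]/shsum (morphB_sum phiB).
by apply: eq_bigr => u _; rewrite hgen_shvec // shsum_vec gp.
Qed.

Lemma shsum_scal c (phi : Z -> Z) : {morph phi : x y / x - y} ->
  (forall w x, g w ((scal c : AB) *: x) = phi (g w x)) ->
  forall v, shsum (scal c *: v) = phi (shsum v).
Proof.
move=> phiB gp v; rewrite {1}(shvec_sum v) scaler_sumr.
rewrite (morphB_sum shsumB) [in RHS]/shsum (morphB_sum phiB).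
by apply: eq_bigr => u _; rewrite scal_shvec shsum_vec gp.
Qed.

End ShSum.

Lemma letters_sorted_word_N : letters false (sorted_word a) N = a.
Proof.
have := lettersC (sorted_word a) N;
  rewrite -{1}eN (letters_sorted_word (c := true)) //; lia.
Qed.

Lemma sorted_word_fgen c j : (j < (if c then b else a).-1)%N ->
  let i := (if c then a + j else j)%N in
  [/\ (i.+1 < N)%N, raise i (sorted_word a) =
    sorted_word a & residue i (sorted_word a) = fgen K a b c j].
Proof.
move=> jc i; have w1 : sorted_word a i = c by rewrite /sorted_word /i;
  case: (c) jc; lia.
have w2 : sorted_word a i.+1 = c by rewrite /sorted_word /i; case: (c) jc; lia.
split; first by rewrite /i; case: (c) jc; lia.
  by rewrite /raise w1 w2 andNb.
rewrite /residue w1 w2 eqxx letters_sorted_word //; case: (c) jc; lia.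
Qed.

Lemma sorted_wordP w : (forall l, (l.+1 < N)%N -> w l -> w l.+1) ->
  letters false w N = a ->
  forall j, (j < N)%N -> w j = sorted_word a j.
Proof.
move=> st wa j jN; rewrite /sorted_word; apply/idP/idP => [wj|].
  by rewrite -wa (sorted_true st jN wj); have := lettersC w j; lia.
apply: contraLR => wj; rewrite -ltnNge -wa -{1}(sorted_false st jN wj).
have := @letters_le false w j.+1 N jN; rewrite /= (negPf wj) /=; lia.
Qed.

(** On the sorted word the rule of [step] is the inclusion of the parabolic
    subalgebra. *)
Lemma top_vec_equivariant y x : shvec N (sorted_word a) (y *: x) =
  par y *: shvec N (sorted_word a) x.
Proof.
have gens c j (z : X) : (j < (if c then b else a).-1)%N ->
    shvec N (sorted_word a) (fgen K a b c j *: z) =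
      par (fgen K a b c j) *: shvec N (sorted_word a) z.
  move=> jc; have [iN nx lb] := sorted_word_fgen jc.
  by rewrite par_fgen // hgen_shvec // nx lb.
elim/(@algT_hecke_ind K a b): y x => [c|j ja|j jb|y z IHy IHz|y z IHy IHz] x.
- by rewrite scal_morphism scal_shvec.
- exact: (gens false j x ja).
- exact: (gens true j x jb).
- by rewrite scalerBl shvecB IHy IHz rmorphB scalerBl.
- by rewrite -scalerA IHy IHz rmorphM scalerA.
Qed.

Definition to_sh : {additive Ind -> Sh} :=
  ind_lift (@shvecB K a b N X (sorted_word a)) top_vec_equivariant.

Lemma to_sh_pure h x : to_sh (ipure par h x) = h *: shvec N (sorted_word a) x.
Proof. exact: ind_liftE. Qed.

Lemma to_shB : {morph to_sh : y z / y - z}.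
Proof. exact: ind_liftB. Qed.

Lemma to_shZ h y : to_sh (h *: y) = h *: to_sh y.
Proof. exact: ind_liftZ. Qed.

Lemma coset_elt_shvec w x : letters false w N = a ->
  coset_elt K N w *: shvec N (sorted_word a) x = shvec N w x.
Proof.
move En: (zero_weight w N) => n; elim/ltn_ind: n w En => n IH w En wa.
have [[i [iN wi wSi]]|st] := descP N w; last first.
  rewrite coset_elt_sorted // scale1r; apply: shvec_ext => j jN.
  by rewrite (sorted_wordP st).
have E := zero_weight_swap iN wi wSi.
rewrite (coset_elt_desc _ iN) // -scalerA (IH _ _ _ (erefl _)); first last.
- by rewrite letters_swap // gtn_eqF.
- by rewrite -En E.
rewrite hgen_shvec // /raise /residue swap_l swap_r wSi wi swapK /=.
by rewrite (negPf wSi) scale1r.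
Qed.

(** Words with a wrong number of letters occur in the shuffle module but not in
    the image of [to_sh]; they are sent to 0. *)
Definition of_sh_fun w x : Ind :=
  if letters false w N == a then ipure par (coset_elt K N w) x else 0.

Lemma of_sh_funB w : {morph of_sh_fun w : x y / x - y}.
Proof. by move=> x y; rewrite /of_sh_fun ipureB; case: ifP; rewrite ?subr0. Qed.

Lemma of_sh_fun_ext w w' x : (forall j, (j < N)%N -> w j = w' j) ->
  of_sh_fun w x = of_sh_fun w' x.
Proof. by move=> ww; rewrite /of_sh_fun (letters_ext _ ww) (coset_elt_ext _ ww). Qed.

Definition of_sh : Sh -> Ind := shsum of_sh_fun.

Lemma of_shZ h v : of_sh (h *: v) = h *: of_sh v.
Proof.
elim/hecke_ind: h v => [c|j jN|y z IHy IHz|y z IHy IHz] v.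
- apply: (shsum_scal of_sh_funB of_sh_fun_ext (ind_scalerB (scal c))) => w x.
  rewrite /of_sh_fun; case: ifP => _; last by rewrite scaler0.
  rewrite ipureZ ind_scaleE scalC; congr (ipure _ (_ * _) _).
  exact: scal_morphism.
- have jN' : (j.+1 < N)%N by lia.
  apply: (shsum_hgen of_sh_funB of_sh_fun_ext jN' (ind_scalerB (hgen K N j))) => w x.
  rewrite /of_sh_fun letters_raise; last by rewrite gtn_eqF.
  case: eqP => wa; last by rewrite scaler0.
  by rewrite ipureZ ind_scaleE (hgen_coset_elt _ eN).
- by rewrite scalerDl /of_sh (morphBD (shsumB of_sh_funB)) -!/(of_sh _) IHy IHz
  scalerDl.
- by rewrite -scalerA IHy IHz scalerA.
Qed.

(** Both maps commute with the algebra, so it suffices to look at the sorted word. *)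
Lemma to_shK y : of_sh (to_sh y) = y.
Proof.
elim/(@ind_indP _ _ par X): y => [h x|y z IHy IHz].
  rewrite to_sh_pure of_shZ /of_sh (shsum_vec of_sh_funB of_sh_fun_ext).
  by rewrite /of_sh_fun letters_sorted_word_N eqxx coset_elt_sorted_word
    ind_scaleE mulr1.
by rewrite raddfB /of_sh (shsumB of_sh_funB) -!/(of_sh _) IHy IHz.
Qed.

(** A consequence of [to_shK]: [of_sh] only takes such sums as values. *)
Lemma ind_span (Q : Ind -> Prop) :
  (forall w x, letters false w N = a -> Q (ipure par (coset_elt K N w) x)) ->
  (forall y z, Q y -> Q z -> Q (y + z)) -> Q 0 -> forall y, Q y.
Proof.
move=> Qw QD Q0 y; rewrite -(to_shK y) /of_sh /shsum.
elim/big_ind: _ => // u _; rewrite /of_sh_fun; case: eqP => // wa; exact: Qw.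
Qed.

End InductionModel.

(** * Cutting words and double cosets *)

Section Mackey.
Variables (K : fieldType) (m n k : nat) (k_le : (k <= m + n)%N).
Variables (M : lmodType (hecke K m)) (L : lmodType (hecke K n)).
Local Notation N := (m + n)%N.
Local Notation k' := (m + n - k)%N.
Local Notation X := (modT M L).
Local Notation J := (algT (hecke K k) (hecke K k')).
Local Notation parJ := (par K (subnKC k_le)).
Local Notation parX := (par K (erefl N)).
Local Notation IP := (ind parX X : lmodType (hecke K N)).
Implicit Types (w : nat -> bool) (p q : mackey_index m n k).

Definition tail w j := w (k + j)%N.

Section Component.
Variable p : mackey_index m n k.
Local Notation t := (mt p).
Local Notation s := (ms p).
Local Notation t' := (m - mt p)%N.
Local Notation s' := (n - ms p)%N.
Local Notation phi := (alg_map (par K (mts_k p)) (par K (mts_mnk p))).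
(** The module induced in the summand [p]. *)
Definition piece : lmodType (algT (algT (hecke K t) (hecke K s)) (algT (hecke K
  t') (hecke K s'))) :=
  Tswap (modT (res (par K (mt_m p)) M) (res (par K (ms_n p)) L)).

Definition retensor (x : X) : piece :=
  restens (par K (mt_m p)) (par K (ms_n p)) M L x.
Definition untensor (x : piece) : X :=
  unrestens (par K (mt_m p)) (par K (ms_n p)) M L x.

Lemma retensorK : cancel retensor untensor.
Proof. exact: restensK. Qed.
Lemma untensorK : cancel untensor retensor.
Proof. exact: unrestensK. Qed.
Lemma retensorB : {morph retensor : x y / x - y}.
Proof.
move=> x y.
exact (@restensB K _ _ _ _ (par K (mt_m p)) (par K (ms_n p)) M L x y).
Qed.
Lemma untensorB : {morph untensor : x y / x - y}.
Proof.
move=> x y.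
exact (@unrestensB K _ _ _ _ (par K (mt_m p)) (par K (ms_n p)) M L x y).
Qed.

Lemma retensorZ a b c d x :
  retensor (apure (par K (mt_m p) (apure a b)) (par K (ms_n p) (apure c d)) *: x) =
  apure (apure a c) (apure b d) *: retensor x.
Proof.
rewrite [LHS]restensZ.
have := mid_swapE (A := hecke K t) (B := hecke K s) (C := hecke K t') (D :=
  hecke K s') a c b d.
move=> e.
rewrite -[RHS]/(mid_swap (hecke K t) (hecke K s) (hecke K t') (hecke K s')
    (apure (apure a c) (apure b d)) *:
  (restens (par K (mt_m p)) (par K (ms_n p)) M L x)).
by rewrite e.
Qed.

(** The first and third tensor factors of the four come from [M], the second and
    fourth from [L]. A generator of [M] or [L] that sits before the cut acts on
    the first two. *)
Lemma retensor_genl c j x : (j < (if c then s else t).-1)%N ->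
  retensor (fgen K m n c j *: x) = apure (fgen K t s c j) 1 *: retensor x.
Proof.
case: c => jc; rewrite -retensorZ.
  by rewrite apure11 rmorph1 par_hgenl.
by rewrite apure11 rmorph1 par_hgenl.
Qed.

Lemma retensor_genr c j x : (j < (if c then s' else t').-1)%N ->
  retensor (fgen K m n c ((if c then s else t) + j) *: x) =
    apure 1 (fgen K t' s' c j) *: retensor x.
Proof.
case: c => jc; rewrite -(apure11 (hecke K t) (hecke K s)) -retensorZ.
  by rewrite apure11 rmorph1 par_hgenr.
by rewrite apure11 rmorph1 par_hgenr.
Qed.

Lemma retensor_scal c x : retensor ((scal c : algT (hecke K m) (hecke K n)) *: x)
  = scal c *: retensor x.
Proof.
have := retensorZ (scal c) 1 1 1 x.
by rewrite apureS1 !apure11 rmorph1 scal_morphism !apureS1.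
Qed.

(** The words of the double coset [p]: [k] letters before the cut, of which
    [mt p] are [false]. The second condition restricts the total count to [m]. *)
Definition in_piece w :=
  (letters false w k == t) && (letters false (tail w) k' == t').

Lemma letters_true_t w : letters false w k = t -> letters true w k = s.
Proof. by move=> wt; have := lettersC w k; have := mts_k p; lia. Qed.

Lemma retensor_residuel i w x : (i.+1 < k)%N -> letters false w k = t ->
  retensor (residue K m n i w *: x) = apure (residue K t s i w) 1 *: retensor x.
Proof.
move=> ik wt; rewrite /residue; case: eqP => [wi|_]; last first.
  by rewrite apure11 !scale1r.
by rewrite retensor_genl //; apply: (letters_residue (mts_k p)).
Qed.

Lemma retensor_residuer i w x : (i.+1 < k')%N -> letters false w k = t ->
  letters false (tail w) k' = t' ->
  retensor (residue K m n (k + i) w *: x) =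
    apure 1 (residue K t' s' i (tail w)) *: retensor x.
Proof.
move=> ik wt wt'; rewrite /residue -addnS; case: eqP => [wi|_]; last first.
  by rewrite apure11 !scale1r.
rewrite letters_cat -/(tail w) -retensor_genr;
  last by apply: (letters_residue (mts_mnk p)).
by rewrite -[tail w i]/(w (k + i)%N); case: (w (k + i)%N);
  rewrite ?wt ?(letters_true_t wt).
Qed.

Definition coset_elt_pair w : J := apure (coset_elt K k w) (coset_elt K k' (tail w)).

(** The value on the vector [coset_elt w] (x) x of the projection to the summand
    [p]. *)
Definition piece_fun w x : ind phi piece :=
  if in_piece w then ipure phi (coset_elt_pair w) (retensor x) else 0.

Lemma piece_funB w : {morph piece_fun w : x y / x - y}.
Proof.
by move=> x y; rewrite /piece_fun retensorB ipureB; case: ifP; rewrite ?subr0.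
Qed.

Lemma piece_fun_ext w w' x : (forall j, (j < N)%N -> w j = w' j) ->
  piece_fun w x = piece_fun w' x.
Proof.
move=> ww.
have wk j : (j < k)%N -> w j = w' j by move=> jk; apply: ww; lia.
have wk' j : (j < k')%N -> tail w j = tail w' j by move=> jk; apply: ww; lia.
by rewrite /piece_fun /in_piece /coset_elt_pair (letters_ext _ wk) (letters_ext _
  wk') (coset_elt_ext _ wk) (coset_elt_ext _ wk').
Qed.

Lemma tail_raise_lt i w : (i.+1 < k)%N -> tail (raise i w) = tail w.
Proof.
move=> ik; apply: functional_extensionality_dep => j.
by rewrite /tail raise_id //; apply/eqP; lia.
Qed.

Lemma tail_raise i w : tail (raise (k + i) w) = raise i (tail w).
Proof.
apply: functional_extensionality_dep => j; rewrite /tail /raise addnS.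
by case: ifP => // _; rewrite /swap addnS -!addnS !eqn_add2l.
Qed.

Lemma piece_fun_hgenl i w x : (i.+1 < k)%N ->
  piece_fun (raise i w) (residue K m n i w *: x) =
    apure (hgen K k i) 1 *: piece_fun w x.
Proof.
move=> ik; rewrite /piece_fun /in_piece tail_raise_lt // letters_raise;
  last by rewrite gtn_eqF.
case: andP => [[/eqP wt _]|]; last by rewrite scaler0.
rewrite retensor_residuel // ipureZ ind_scaleE; congr (ipure _ _ _).
rewrite /coset_elt_pair tail_raise_lt // [X in _ * X](alg_mapE _ _ (residue K t s
  i w) 1) !apureM.
by rewrite rmorph1 mulr1 mul1r (hgen_coset_elt K (mts_k p)).
Qed.

Lemma piece_fun_hgenr i w x : (i.+1 < k')%N ->
  piece_fun (raise (k + i) w) (residue K m n (k + i) w *: x) =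
    apure 1 (hgen K k' i) *: piece_fun w x.
Proof.
move=> ik; have Tl : coset_elt K k (raise (k + i) w) = coset_elt K k w.
  by apply: coset_elt_ext => j jk; rewrite raise_id //; apply/eqP; lia.
have cl : letters false (raise (k + i) w) k =
  letters false w k by apply: letters_raise; lia.
rewrite /piece_fun /in_piece tail_raise cl letters_raise; last by rewrite gtn_eqF.
case: andP => [[/eqP wt /eqP wt']|]; last by rewrite scaler0.
rewrite retensor_residuer // ipureZ ind_scaleE; congr (ipure _ _ _).
rewrite /coset_elt_pair tail_raise Tl [X in _ * X](alg_mapE _ _ 1 (residue K t' s'
  i (tail w))) !apureM.
by rewrite rmorph1 mulr1 mul1r (hgen_coset_elt K (mts_mnk p)).
Qed.

Definition split_piece (v : shmod N X) : ind phi piece := shsum piece_fun v.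

Lemma split_pieceB : {morph split_piece : v v' / v - v'}.
Proof. exact: shsumB piece_funB. Qed.

Lemma split_piece_vec w x : split_piece (shvec N w x) = piece_fun w x.
Proof. exact: (shsum_vec piece_funB piece_fun_ext). Qed.

Lemma split_pieceZ (y : J) v : split_piece (parJ y *: v) = y *: split_piece v.
Proof.
elim/(@algT_hecke_ind K k k'): y v => [c|j jk|j jk|y z IHy IHz|y z IHy IHz] v.
- rewrite scal_morphism; apply: (shsum_scal piece_funB piece_fun_ext) => [x y|w x].
    exact: ind_scalerB.
  rewrite /piece_fun; case: ifP => _; last by rewrite scaler0.
  rewrite retensor_scal ipureZ ind_scaleE scalC; congr (ipure _ (_ * _) _).
  exact: scal_morphism.
- have jk' : (j.+1 < k)%N by lia.
  rewrite par_hgenl //; apply: (shsum_hgen piece_funB piece_fun_ext) => [|x y|w x].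
  + by lia.
  + exact: ind_scalerB.
  + exact: piece_fun_hgenl.
- have jk' : (j.+1 < k')%N by lia.
  rewrite par_hgenr //; apply: (shsum_hgen piece_funB piece_fun_ext) => [|x y|w x].
  + by lia.
  + exact: ind_scalerB.
  + exact: piece_fun_hgenr.
- by rewrite rmorphB scalerBl split_pieceB IHy IHz scalerBl.
- by rewrite rmorphM -scalerA IHy IHz scalerA.
Qed.

(** The minimal representative of the double coset: both halves are sorted. *)
Definition dword j : bool :=
  if (j < k)%N then sorted_word t j else sorted_word t' (j - k).

Lemma dword_lt j : (j < k)%N -> dword j = sorted_word t j.
Proof. by rewrite /dword => ->. Qed.

Lemma tail_dword : tail dword = sorted_word t'.
Proof.
apply: functional_extensionality_dep => j.
by rewrite /tail /dword ltnNge leq_addr addKn.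
Qed.

Lemma letters_dword c i : (i <= k)%N ->
  letters c dword i = letters c (sorted_word t) i.
Proof. by move=> ik; apply: letters_ext => j ji; apply: dword_lt; lia. Qed.

Lemma letters_dword_k : letters false dword k = t.
Proof. by rewrite letters_dword // (letters_sorted_word_N (mts_k p)). Qed.

Lemma letters_dword_N : letters false dword N = m.
Proof.
have e : N = (k + k')%N by rewrite subnKC.
rewrite e letters_cat letters_dword_k -/(tail dword) tail_dword
  (letters_sorted_word_N (mts_mnk p)).
exact: mt_m.
Qed.

Lemma hgen_coset_elt_dword i c : (i.+1 < N)%N -> dword i = c -> dword i.+1 = c ->
  hgen K N i * coset_elt K N dword =
    coset_elt K N dword * parX (fgen K m n c (letters c dword i)).
Proof.
move=> iN d1 d2; rewrite (hgen_coset_elt K (erefl N)) ?letters_dword_N //.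
by rewrite /raise /residue d1 d2 eqxx andNb.
Qed.

(** The embedding of the summand [p], on the vectors 1 (x) x. *)
Definition glue_fun (x : piece) : res parJ IP :=
  ipure parX (coset_elt K N dword) (untensor x).

Lemma glue_funB : {morph glue_fun : x y / x - y}.
Proof. by move=> x y; rewrite /glue_fun untensorB; exact: ipureB. Qed.

Lemma glue_genl c j x : (j < (if c then s else t).-1)%N ->
  glue_fun (apure (fgen K t s c j) 1 *: x) =
  hgen K N (if c then t + j else j)%N *: (glue_fun x : IP).
Proof.
move=> jc; have tk := mts_k p.
rewrite -[x]untensorK -retensor_genl // /glue_fun !retensorK [RHS]ind_scaleE ipureZ.
congr (ipure _ _ _); rewrite (@hgen_coset_elt_dword _ c).
- congr (_ * parX (fgen K m n c _)); rewrite letters_dword;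
  last by case: (c) jc => /=; lia.
  by rewrite letters_sorted_word //; case: (c) jc => /=; lia.
- case: (c) jc => /=; lia.
- by rewrite dword_lt /sorted_word; case: (c) jc => /=; lia.
- by rewrite dword_lt /sorted_word; case: (c) jc => /=; lia.
Qed.

Lemma glue_genr c j x : (j < (if c then s' else t').-1)%N ->
  glue_fun (apure 1 (fgen K t' s' c j) *: x) =
  hgen K N (k + (if c then t' + j else j))%N *: (glue_fun x : IP).
Proof.
move=> jc; have tk := mts_mnk p.
rewrite -[x]untensorK -retensor_genr // /glue_fun !retensorK [RHS]ind_scaleE ipureZ.
congr (ipure _ _ _); rewrite (@hgen_coset_elt_dword _ c).
- congr (_ * parX (fgen K m n c _));
  rewrite letters_cat -/(tail dword) tail_dword letters_sorted_word; last first.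
    by case: (c) jc => /=; lia.
  by case: (c); rewrite ?letters_dword_k // (letters_true_t letters_dword_k).
- case: (c) jc => /=; lia.
- rewrite -[dword _]/(tail dword _) tail_dword /sorted_word; case: (c) jc => /=; lia.
- rewrite -addnS -[dword _]/(tail dword _) tail_dword /sorted_word;
  case: (c) jc => /=; lia.
Qed.

(** The relation s_i d = d s_j, where s_i runs over the generators of the
    intersection of one parabolic subgroup with a conjugate of the other. *)
Lemma glue_funZ b x : glue_fun (b *: x) = phi b *: glue_fun x.
Proof.
pose Q b := forall x, glue_fun (b *: x) = phi b *: glue_fun x.
have Qs c : Q (scal c).
  move=> {}x; rewrite [phi _]scal_morphism.
  rewrite -[RHS]/(parJ (scal c) *: (glue_fun x : IP)) scal_morphism.
  rewrite -[x]untensorK -retensor_scal /glue_fun !retensorK ipureZ ind_scaleE scalC.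
  by congr (ipure _ (_ * _) _); exact: scal_morphism.
have QB a b' : Q a -> Q b' -> Q (a - b').
  by move=> Qa Qb {}x; rewrite scalerBl glue_funB Qa Qb rmorphB scalerBl.
have QM a b' : Q a -> Q b' -> Q (a * b').
  by move=> Qa Qb {}x; rewrite -scalerA Qa Qb rmorphM scalerA.
have Ql c j : (j < (if c then s else t).-1)%N -> Q (apure (fgen K t s c j) 1).
  move=> jc {}x; rewrite glue_genl // [phi _]alg_mapE rmorph1 par_fgen //.
  rewrite -[RHS]/(parJ (apure (hgen K k _) 1) *: (glue_fun x : IP)) par_hgenl //.
  have := mts_k p; case: (c) jc => /=; lia.
have Qr c j : (j < (if c then s' else t').-1)%N -> Q (apure 1 (fgen K t' s' c j)).
  move=> jc {}x; rewrite glue_genr // [phi _]alg_mapE rmorph1 par_fgen //.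
  rewrite -[RHS]/(parJ (apure 1 (hgen K k' _)) *: (glue_fun x : IP)) par_hgenr //.
  have := mts_mnk p; case: (c) jc => /=; lia.
move: b x; apply: algT_gen_ind => //.
- apply: algT_hecke_ind => [c|j jt|j js|y z Qy Qz|y z Qy Qz].
  + exact: Qs.
  + exact: (Ql false).
  + exact: (Ql true).
  + rewrite -[apure _ 1]/(alg_inl _) rmorphB; exact: QB.
  + rewrite -[apure _ 1]/(alg_inl _) rmorphM; exact: QM.
- apply: algT_hecke_ind => [c|j jt|j js|y z Qy Qz|y z Qy Qz].
  + rewrite -[apure 1 _]/(alg_inr _) scal_morphism; exact: Qs.
  + exact: (Qr false).
  + exact: (Qr true).
  + rewrite -[apure 1 _]/(alg_inr _) rmorphB; exact: QB.
  + rewrite -[apure 1 _]/(alg_inr _) rmorphM; exact: QM.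
Qed.

Definition glue : {additive ind phi piece -> res parJ IP} :=
  ind_lift glue_funB glue_funZ.

Lemma glueE y x : glue (ipure phi y x) =
  ipure parX (parJ y * coset_elt K N dword) (untensor x).
Proof. by rewrite [LHS]ind_liftE [LHS]ind_scaleE. Qed.

(** A representative v in the double coset of d factors as v = u d with u in the
    parabolic subgroup, and u is the pair of representatives read off the halves
    of the word. *)
Lemma coset_elt_split w : letters false w k = t -> letters false (tail w) k' = t' ->
  coset_elt K N w = parJ (coset_elt_pair w) * coset_elt K N dword.
Proof.
move En: (zero_weight w N) => r; elim/ltn_ind: r w En => r IH w En wt wt'.
have [[i [ik wi wSi]]|st] := descP k w.
  have iN : (i.+1 < N)%N by lia.
  have ts : tail (swap i w) = tail w.
    apply: functional_extensionality_dep => j.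
    by rewrite /tail swap_id //; apply/eqP; lia.
  rewrite (coset_elt_desc _ iN) // (IH _ _ _ (erefl _)) ?ts //; first last.
  - by rewrite letters_swap // gtn_eqF.
  - by rewrite -En (zero_weight_swap iN wi wSi).
  rewrite mulrA -(par_hgenl K (subnKC k_le)); last by lia.
  by rewrite -rmorphM /coset_elt_pair apureM mul1r ts -(coset_elt_desc _ ik).
have [[i [ik wi wSi]]|st'] := descP k' (tail w).
  rewrite /tail addnS in wi wSi.
  have iN : ((k + i).+1 < N)%N by lia.
  have ts : tail (swap (k + i) w) = swap i (tail w).
    by apply: functional_extensionality_dep => j;
      rewrite /tail /swap -!addnS !eqn_add2l.
  rewrite (coset_elt_desc _ iN) // (IH _ _ _ (erefl _)) ?ts //; first last.
  - by rewrite letters_swap // gtn_eqF.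
  - by rewrite letters_swap_lt // leq_addr.
  - by rewrite -En (zero_weight_swap iN wi wSi).
  rewrite mulrA -(par_hgenr K (subnKC k_le)); last by lia.
  rewrite -rmorphM /coset_elt_pair apureM mul1r ts -(coset_elt_desc _ ik) ?/tail
    ?addnS //.
  congr (parJ (apure _ _) * _); apply: coset_elt_ext => j jk; rewrite swap_id //;
    apply/eqP; lia.
rewrite /coset_elt_pair (coset_elt_sorted _ st) (coset_elt_sorted _ st') apure11
  rmorph1 mul1r.
apply: coset_elt_ext => j jN; case: (ltnP j k) => jk.
  by rewrite dword_lt // (sorted_wordP (mts_k p) st).
have e : j = (k + (j - k))%N by rewrite subnKC.
rewrite e -[RHS]/(tail dword _) tail_dword -[LHS]/(tail w _) (sorted_wordP
  (mts_mnk p) st') //; lia.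
Qed.

Lemma glueB : {morph glue : y z / y - z}.
Proof. exact (ind_liftB glue_funB glue_funZ). Qed.

Definition to_piece (y : res parJ IP) : ind phi piece :=
  split_piece (to_sh (erefl N) X y).

Lemma to_pieceB : {morph to_piece : y z / y - z}.
Proof.
move=> y z; rewrite /to_piece -split_pieceB; congr split_piece.
exact (@to_shB K m n N (erefl N) X y z).
Qed.

Lemma to_pieceZ (a : J) y : to_piece (a *: y) = a *: to_piece y.
Proof.
rewrite /to_piece -split_pieceZ; congr split_piece.
exact (@to_shZ K m n N (erefl N) X (parJ a) y).
Qed.

Lemma to_piece_coset_elt w x : letters false w N = m ->
  to_piece (ipure parX (coset_elt K N w) x) = piece_fun w x.
Proof.
by move=> wm; rewrite /to_piece to_sh_pure (coset_elt_shvec (erefl N)) //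
  split_piece_vec.
Qed.

Lemma to_piece_glue_pure y x : to_piece (glue (ipure phi y x)) =
  y *: piece_fun dword (untensor x).
Proof.
by rewrite glueE -[ipure _ _ _](ind_scaleE parX) [LHS]to_pieceZ to_piece_coset_elt
  ?letters_dword_N.
Qed.

Lemma to_piece_glue y : to_piece (glue y) = y.
Proof.
elim/(@ind_indP _ _ phi piece): y => [y x|y z IHy IHz]; last first.
  by rewrite glueB to_pieceB IHy IHz.
rewrite to_piece_glue_pure /piece_fun /in_piece letters_dword_k tail_dword
  (letters_sorted_word_N (mts_mnk p)).
rewrite !eqxx /= ind_scaleE untensorK /coset_elt_pair tail_dword
  coset_elt_sorted_word.
rewrite (coset_elt_ext _ (w' := sorted_word t)); last exact: dword_lt.
by rewrite coset_elt_sorted_word apure11 mulr1.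
Qed.

End Component.

(** The double cosets are told apart by the number of letters [false] before the
    cut. *)
Lemma mt_inj : injective (@mt m n k).
Proof.
move=> p q e; have es : ms p = ms q by have := mts_k p; have := mts_k q; lia.
by apply: val_inj; apply: injective_projections; apply: val_inj.
Qed.

Local Notation phi p := (alg_map (par K (mts_k p)) (par K (mts_mnk p))).

Lemma to_piece_glue_ne p q y : q != p -> to_piece q (glue p y) = 0.
Proof.
move=> pq; elim/(@ind_indP _ _ (phi p) (piece p)): y => [y x|y z IHy IHz]; last first.
  rewrite (@glueB p y z) (@to_pieceB q (glue p y) (glue p z)) IHy IHz; exact: subr0.
rewrite glueE -[ipure _ _ _](ind_scaleE parX) [LHS](@to_pieceZ q).
rewrite (@to_piece_coset_elt q) ?letters_dword_N // /piece_fun /in_piece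
  letters_dword_k.
by rewrite (negPf (contra_neq _ pq)) ?scaler0 // => e; exact: mt_inj.
Qed.

Lemma ex_piece w : letters false w N = m -> exists p, in_piece p w.
Proof.
have -> : N = (k + k')%N by rewrite subnKC.
rewrite letters_cat => wm.
have wk := lettersC w k; have wk' := lettersC (tail w) k'; rewrite -/(tail w) in wm.
have tm : (letters false w k < m.+1)%N by lia.
have sn : (letters true w k < n.+1)%N by lia.
have ts : ((Ordinal tm, Ordinal sn).1 + (Ordinal tm, Ordinal sn).2 == k)%N.
  by rewrite /= addnC wk.
exists (Sub (Ordinal tm, Ordinal sn) ts).
by rewrite /in_piece /mt SubK /=; lia.
Qed.

Lemma piece_span (Q : res parJ IP -> Prop) :
  (forall p y, glue p (to_piece p y) = y -> (forall q, q != p ->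
    to_piece q y = 0) -> Q y) ->
  (forall y z, Q y -> Q z -> Q (y + z)) -> Q 0 -> forall y, Q y.
Proof.
move=> Qp QD Q0; apply: (ind_span (eN := erefl N)) => // w x wm.
have [p wp] := ex_piece wm; move: (wp) => /andP[/eqP wt /eqP wt'].
apply: (Qp p) => [|q qp]; rewrite to_piece_coset_elt // /piece_fun.
  by rewrite wp glueE retensorK -(coset_elt_split wt wt').
by rewrite /in_piece wt (negPf (contra_neq _ qp)) // => e; exact: mt_inj.
Qed.

(** The formula for arbitrary modules: double cosets do not interact, because
    [raise] at i with i + 1 < k or k <= i moves no letter across the cut. *)
Lemma mackey : exists f : {linear res parJ (indprod M L) -> dsum (fun p =>
    ind (phi p) (Tswap (modT (res (par K (mt_m p)) M) (res (par K (ms_n p)) L))))},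
  bijective f.
Proof.
rewrite /indprod; pose D p : lmodType J := ind (phi p) (piece p).
pose f p : res parJ IP -> D p := @to_piece p.
pose g p : D p -> res parJ IP := glue p.
have fB p : {morph f p : x y / x - y} by exact (@to_pieceB p).
have fZ p a y : f p (a *: y) = a *: f p y by exact (@to_pieceZ p a y).
have gB p : {morph g p : x y / x - y} by exact (@glueB p).
have gK p : cancel (g p) (f p) by exact (@to_piece_glue p).
have fg0 p q y : q != p -> f q (g p y) = 0 by exact (@to_piece_glue_ne p q y).
have := dsum_decomposition fB fZ gB gK fg0 piece_span.
by rewrite /D /piece.
Qed.

End Mackey.

Local Close Scope ring_scope.

Theorem theorem3p14 (R : realType) (m n k : nat)
    (m_gt0 : 0 < m) (n_gt0 : 0 < n) (k_gt0 : 1 <= k) (k_lt : k < m + n)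
    (sigma rho : 'S_m) (sigma' rho' : 'S_n) :
  exists f : {linear
      res (par R[i] (subnKC (ltnW k_lt)))
        (indprod (Bmod R[i] sigma rho) (Bmod R[i] sigma' rho'))
      -> dsum (fun p : mackey_index m n k =>
           ind (alg_map (par R[i] (mts_k p)) (par R[i] (mts_mnk p)))
             (Tswap (modT (res (par R[i] (mt_m p)) (Bmod R[i] sigma rho))
                          (res (par R[i] (ms_n p)) (Bmod R[i] sigma' rho')))))},
    bijective f.
Proof.
exact (mackey (ltnW k_lt) (Bmod R[i] sigma rho) (Bmod R[i] sigma' rho')).
Qed.
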